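(* Let $L$ be an oriented virtual link represented by an oriented virtual link diagram $D$. Let $(VBQ(L),f,R)$ be the fundamental virtual biquandle of $L$, i.e. the virtual biquandle generated by the semiarcs of $D$ subject to the standard crossing relations, and let $(X,f',R')$ be the virtual biquandle generated by the semiarcs of $D$ subject to the new crossing relations (in which virtual crossings simply exchange the labels). Then $(X,f',R')$ and $(VBQ(L),f,R)$ are isomorphic as virtual biquandles.
   Context: A biquandle is a non-empty set $X$ with a map $R\colon X\times X\to X\times X$, $R(x,y)=(R_1(x,y),R_2(x,y))$, such that: (1) $(R\times \mathrm{id})(\mathrm{id}\times R)(R\times \mathrm{id})=(\mathrm{id}\times R)(R\times \mathrm{id})(\mathrm{id}\times R)$ on $X^3$; (2) $R$ is invertible; (3) for any $x,z\in X$ there is a unique $y\in X$ with $R_1(x,y)=z$; (4) for any $y,w\in X$ there is a unique $x\in X$ with $R_2(x,y)=w$; (5) for any $a\in X$ there is a unique $x\in X$ with $R(x,a)=(x,a)$. Write $R^{-1}=(\overline{R_1},\overline{R_2})$. A biquandle homomorphism $(X,R)\to(Y,S)$ is a map $\phi$ with $(\phi\times\phi)\circ R=S\circ(\phi\times\phi)$. A virtual biquandle is a triple $(X,f,R)$ where $(X,R)$ is a biquandle and $f\colon X\to X$ is an automorphism of $(X,R)$; a homomorphism $(X,f,R)\to(Y,g,S)$ is a biquandle homomorphism $\phi$ with $\phi\circ f=g\circ\phi$, and an isomorphism is a bijective homomorphism. The virtual biquandle generated by a set $S$ subject to a set of relations is the quotient of the free virtual biquandle on $S$ by the equivalence relation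 (congruence) generated by the relations; equivalently, it is the universal virtual biquandle with a map from $S$ for which the relations hold. A virtual link diagram is a generic immersion of finitely many circles in the plane $\mathbb{R}^2$ or the sphere $\mathbb{S}^2$ whose double points are each decorated either as a classical crossing (with over/under information) or as a virtual crossing (no such information). An oriented virtual link is an equivalence class of oriented diagrams under planar isotopy and the generalized Reidemeister moves: the classical Reidemeister moves I, II, III; the same three moves with all crossings virtual; and the mixed move in which a strand having two consecutive virtual crossings passes across a classical crossing. A semiarc is an arc of $D$ between two consecutive double points (classical or virtual); a component without double points is a single semiarc. At each crossing, rotate the picture in the plane so that both strands point downward; call the incoming semiarcs top-left ($x$) and top-right ($y$), and the outgoing ones bottom-left ($z$) and bottom-right ($w$). A classical crossing is positive if the over-strand runs from top-right to bottom-left, and negative if the over-strand runs from top-left to bottom-right. Standard crossing relations (defining $(VBQ(L),f,R)$): $z=R_1(x,y)$, $w=R_2(x,y)$ at a positive crossing; $z=\overline{R_1}(x,y)$, $w=\overline{R_2}(x,y)$ at a negative crossing; $z=f^{-1}(y)$, $w=f(x)$ at a virtual crossing. It is known that, up to isomorphism, $(VBQ(L),f,R)$ is independent of the diagram $D$ representing $L$. New crossing relations (defining $(X,f',R')$, with $R'=(R'_1,R'_2)$ and $R'^{-1}=(\overline{R'_1},\overline{R'_2})$): $z=R'_1(x,f'(y))$, $w=R'_2(f'^{-1}(x),y)$ at a positive crossing; $z=\overline{R'_1}(x,f'(y))$, $w=\overline{R'_2}(f'^{-1}(x),y)$ at a negative crossing; $z=y$, $w=x$ at a virtual crossing. *)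

(* Defs.v *)
From Stdlib Require Import Reals ZArith List Lra Lia.
From Stdlib Require Import ClassicalEpsilon FunctionalExtensionality
  PropExtensionality ProofIrrelevance.
From Stdlib Require Fin.
From Coquelicot Require Import Coquelicot.

Section YangBaxter.
Context {X : Type} (R : X * X -> X * X).

Definition R_id (t : X * X * X) : X * X * X :=
  let '(x, y, z) := t in (fst (R (x, y)), snd (R (x, y)), z).

Definition id_R (t : X * X * X) : X * X * X :=
  let '(x, y, z) := t in (x, fst (R (y, z)), snd (R (y, z))).

End YangBaxter.

Definition mutually_inverse {A B : Type} (g : A -> B) (h : B -> A) : Prop :=
  (forall a, h (g a) = a) /\ (forall b, g (h b) = b).

Definition invertible {A B : Type} (g : A -> B) : Prop :=
  exists h : B -> A, mutually_inverse g h.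

Record is_biquandle (X : Type) (R : X * X -> X * X) : Prop := {
  bq_inhabited : inhabited X;
  bq_yang_baxter : forall t, R_id R (id_R R (R_id R t)) = id_R R (R_id R (id_R R t));
  bq_invertible : invertible R;
  bq_left : forall x z, exists! y, fst (R (x, y)) = z;
  bq_right : forall y w, exists! x, snd (R (x, y)) = w;
  bq_fix : forall a, exists! x, R (x, a) = (x, a)
}.

Definition pair_map {X Y : Type} (phi : X -> Y) (p : X * X) : Y * Y :=
  (phi (fst p), phi (snd p)).

Definition is_biquandle_hom {X Y : Type} (R : X * X -> X * X) (S : Y * Y -> Y * Y)
    (phi : X -> Y) : Prop :=
  forall p, pair_map phi (R p) = S (pair_map phi p).

Record virtual_biquandle := {
  vb_carrier :> Type;
  vb_f : vb_carrier -> vb_carrier;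
  vb_R : vb_carrier * vb_carrier -> vb_carrier * vb_carrier;
  vb_biquandle : is_biquandle vb_carrier vb_R;
  vb_f_hom : is_biquandle_hom vb_R vb_R vb_f;
  vb_f_invertible : invertible vb_f
}.

Definition is_vb_hom (X Y : virtual_biquandle) (phi : X -> Y) : Prop :=
  is_biquandle_hom (vb_R X) (vb_R Y) phi /\
  forall x, phi (vb_f X x) = vb_f Y (phi x).

Definition vb_isomorphic (X Y : virtual_biquandle) : Prop :=
  exists phi : X -> Y, is_vb_hom X Y phi /\ forall y, exists! x, phi x = y.

(** Besides [f], [R_1] and [R_2], the terms use the operations whose existence
    the axioms assert: [f^{-1}], the components of [R^{-1}], the solution
    [Olsol x z] of [R_1(x,_) = z], the solution [Orsol y w] of [R_2(_,y) = w]
    and the solution [Ofix a] of [R(_,a) = (_,a)].  Uniqueness of the last one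
    follows from uniqueness in [R_2(_,a) = a], so virtual biquandles are
    exactly the nonempty models of the equations listed in [cong]. *)

Inductive unop := Of | Ofinv | Ofix.
Inductive binop := OR1 | OR2 | ORinv1 | ORinv2 | Olsol | Orsol.

Inductive term (S : Type) :=
| gen (s : S)
| app1 (o : unop) (t : term S)
| app2 (o : binop) (t u : term S).
Arguments gen {S} s.
Arguments app1 {S} o t.
Arguments app2 {S} o t u.

Definition tR {S} (p : term S * term S) : term S * term S :=
  (app2 OR1 (fst p) (snd p), app2 OR2 (fst p) (snd p)).
Definition tRinv {S} (p : term S * term S) : term S * term S :=
  (app2 ORinv1 (fst p) (snd p), app2 ORinv2 (fst p) (snd p)).

Section Congruence.
Context {S : Type} (rel : term S -> term S -> Prop).

Inductive cong : term S -> term S -> Prop :=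
| cong_rel t u : rel t u -> cong t u
| cong_refl t : cong t t
| cong_sym t u : cong t u -> cong u t
| cong_trans t u v : cong t u -> cong u v -> cong t v
| cong_app1 o t t' : cong t t' -> cong (app1 o t) (app1 o t')
| cong_app2 o t t' u u' : cong t t' -> cong u u' -> cong (app2 o t u) (app2 o t' u')
| cong_yb1 t : cong (fst (fst (R_id tR (id_R tR (R_id tR t)))))
                    (fst (fst (id_R tR (R_id tR (id_R tR t)))))
| cong_yb2 t : cong (snd (fst (R_id tR (id_R tR (R_id tR t)))))
                    (snd (fst (id_R tR (R_id tR (id_R tR t)))))
| cong_yb3 t : cong (snd (R_id tR (id_R tR (R_id tR t))))
                    (snd (id_R tR (R_id tR (id_R tR t))))
| cong_RinvR1 p : cong (fst (tRinv (tR p))) (fst p)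
| cong_RinvR2 p : cong (snd (tRinv (tR p))) (snd p)
| cong_RRinv1 p : cong (fst (tR (tRinv p))) (fst p)
| cong_RRinv2 p : cong (snd (tR (tRinv p))) (snd p)
| cong_lsol x z : cong (app2 OR1 x (app2 Olsol x z)) z
| cong_lsol_uniq x y : cong (app2 Olsol x (app2 OR1 x y)) y
| cong_rsol y w : cong (app2 OR2 (app2 Orsol y w) y) w
| cong_rsol_uniq x y : cong (app2 Orsol y (app2 OR2 x y)) x
| cong_fix1 a : cong (app2 OR1 (app1 Ofix a) a) (app1 Ofix a)
| cong_fix2 a : cong (app2 OR2 (app1 Ofix a) a) a
| cong_f1 x y : cong (app1 Of (app2 OR1 x y)) (app2 OR1 (app1 Of x) (app1 Of y))
| cong_f2 x y : cong (app1 Of (app2 OR2 x y)) (app2 OR2 (app1 Of x) (app1 Of y))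
| cong_finvf t : cong (app1 Ofinv (app1 Of t)) t
| cong_ffinv t : cong (app1 Of (app1 Ofinv t)) t.

Definition presented_carrier : Type :=
  {C : term S -> Prop | exists t, C = cong t}.

Definition cls (t : term S) : presented_carrier :=
  exist _ (cong t) (ex_intro _ t eq_refl).

Arguments cls t : simpl never.

Definition repr (c : presented_carrier) : term S :=
  proj1_sig (constructive_indefinite_description _ (proj2_sig c)).

Lemma cls_repr c : cls (repr c) = c.
Proof.
destruct c as [C HC]; unfold repr, cls; simpl.
destruct (constructive_indefinite_description _ HC) as [t Ht]; simpl; subst C.
apply f_equal, proof_irrelevance.
Qed.

Lemma cls_eq t u : cls t = cls u <-> cong t u.
Proof.
split.
- intros H; apply (f_equal (@proj1_sig _ _)) in H; unfold cls in H; simpl in H.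
  rewrite H; apply cong_refl.
- intros H.
  assert (E : cong t = cong u).
  { apply functional_extensionality; intros v; apply propositional_extensionality.
    split; intros K.
    - apply cong_trans with t; [now apply cong_sym|exact K].
    - now apply cong_trans with u. }
  unfold cls; apply eq_sig_hprop; [intros; apply proof_irrelevance|exact E].
Qed.

Lemma repr_cls t : cong (repr (cls t)) t.
Proof. apply cls_eq, cls_repr. Qed.

Definition presented_f (c : presented_carrier) : presented_carrier :=
  cls (app1 Of (repr c)).

Definition presented_R (p : presented_carrier * presented_carrier) :
    presented_carrier * presented_carrier :=
  pair_map cls (tR (pair_map repr p)).

Arguments presented_f c : simpl never.
Arguments presented_R p : simpl never.

Lemma presented_fE t : presented_f (cls t) = cls (app1 Of t).
Proof. apply cls_eq, cong_app1, repr_cls. Qed.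

Lemma presented_RE t u :
  presented_R (cls t, cls u) = (cls (app2 OR1 t u), cls (app2 OR2 t u)).
Proof.
unfold presented_R, pair_map; simpl.
f_equal; apply cls_eq; apply cong_app2; apply repr_cls.
Qed.

Lemma cls_ind (P : presented_carrier -> Prop) : (forall t, P (cls t)) -> forall c, P c.
Proof. intros H c; rewrite <- (cls_repr c); apply H. Qed.

Lemma cls_congr2 o t t' u u' :
  cls t = cls t' -> cls u = cls u' -> cls (app2 o t u) = cls (app2 o t' u').
Proof. intros H K; apply cls_eq; apply cong_app2; now apply cls_eq. Qed.

Lemma presented_is_biquandle : inhabited S -> is_biquandle presented_carrier presented_R.
Proof.
intros [s]; split.
- exact (inhabits (cls (gen s))).
- intros [[x y] z]; revert x y z.
  refine (cls_ind _ _); intros x; refine (cls_ind _ _); intros y;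
  refine (cls_ind _ _); intros z.
  unfold R_id, id_R; repeat (rewrite presented_RE; cbn [fst snd]).
  f_equal; [f_equal|]; apply cls_eq.
  + exact (cong_yb1 (x, y, z)).
  + exact (cong_yb2 (x, y, z)).
  + exact (cong_yb3 (x, y, z)).
- exists (fun p => pair_map cls (tRinv (pair_map repr p))).
  assert (E : forall t u, pair_map cls (tRinv (pair_map repr (cls t, cls u)))
              = (cls (app2 ORinv1 t u), cls (app2 ORinv2 t u))).
  { intros t u; unfold pair_map; simpl.
    f_equal; apply cls_eq; apply cong_app2; apply repr_cls. }
  split; intros [x y]; revert x y;
  refine (cls_ind _ _); intros x; refine (cls_ind _ _); intros y.
  + rewrite presented_RE, E; f_equal; apply cls_eq.
    * exact (cong_RinvR1 (x, y)).
    * exact (cong_RinvR2 (x, y)).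
  + rewrite E, presented_RE; f_equal; apply cls_eq.
    * exact (cong_RRinv1 (x, y)).
    * exact (cong_RRinv2 (x, y)).
- refine (cls_ind _ _); intros x; refine (cls_ind _ _); intros z.
  exists (cls (app2 Olsol x z)); split.
  + rewrite presented_RE; apply cls_eq, cong_lsol.
  + refine (cls_ind _ _); intros y; rewrite presented_RE; simpl; intros H.
    rewrite <- (proj2 (cls_eq _ _) (cong_lsol_uniq x y)).
    apply cls_congr2; [reflexivity|now symmetry].
- refine (cls_ind _ _); intros y; refine (cls_ind _ _); intros w.
  exists (cls (app2 Orsol y w)); split.
  + rewrite presented_RE; apply cls_eq, cong_rsol.
  + refine (cls_ind _ _); intros x; rewrite presented_RE; simpl; intros H.
    rewrite <- (proj2 (cls_eq _ _) (cong_rsol_uniq x y)).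
    apply cls_congr2; [reflexivity|now symmetry].
- refine (cls_ind _ _); intros a.
  exists (cls (app1 Ofix a)); split.
  + rewrite presented_RE; f_equal; apply cls_eq; [apply cong_fix1|apply cong_fix2].
  + refine (cls_ind _ _); intros x; rewrite presented_RE; intros H.
    apply (f_equal snd) in H; cbn [snd] in H.
    apply cls_eq.
    apply cong_trans with (app2 Orsol a (app2 OR2 (app1 Ofix a) a));
      [apply cong_sym, cong_rsol_uniq|].
    apply cong_trans with (app2 Orsol a (app2 OR2 x a)); [|apply cong_rsol_uniq].
    apply cong_app2; [apply cong_refl|].
    apply cong_trans with a; [apply cong_fix2|].
    apply cong_sym, cls_eq, H.
Qed.

Lemma presented_f_hom : is_biquandle_hom presented_R presented_R presented_f.
Proof.
intros [x y]; revert x y.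
refine (cls_ind _ _); intros x; refine (cls_ind _ _); intros y.
rewrite presented_RE; unfold pair_map; simpl; rewrite !presented_fE, presented_RE.
f_equal; apply cls_eq; [apply cong_f1|apply cong_f2].
Qed.

Lemma presented_f_invertible : invertible presented_f.
Proof.
exists (fun c => cls (app1 Ofinv (repr c))).
assert (E : forall t, cls (app1 Ofinv (repr (cls t))) = cls (app1 Ofinv t)).
{ intros t; apply cls_eq, cong_app1, repr_cls. }
split; refine (cls_ind _ _); intros t; rewrite ?E, ?presented_fE, ?E; apply cls_eq.
- apply cong_finvf.
- apply cong_ffinv.
Qed.

Definition presented (HS : inhabited S) : virtual_biquandle := {|
  vb_carrier := presented_carrier;
  vb_f := presented_f;
  vb_R := presented_R;
  vb_biquandle := presented_is_biquandle HS;
  vb_f_hom := presented_f_hom;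
  vb_f_invertible := presented_f_invertible
|}.

End Congruence.

Section Operations.
Context (Y : virtual_biquandle).

Definition vb_finv : Y -> Y :=
  proj1_sig (constructive_indefinite_description _ (vb_f_invertible Y)).
Definition vb_Rinv : Y * Y -> Y * Y :=
  proj1_sig (constructive_indefinite_description _ (bq_invertible _ _ (vb_biquandle Y))).
Definition vb_lsol (x z : Y) : Y :=
  proj1_sig (constructive_indefinite_description _ (bq_left _ _ (vb_biquandle Y) x z)).
Definition vb_rsol (y w : Y) : Y :=
  proj1_sig (constructive_indefinite_description _ (bq_right _ _ (vb_biquandle Y) y w)).
Definition vb_fix (a : Y) : Y :=
  proj1_sig (constructive_indefinite_description _ (bq_fix _ _ (vb_biquandle Y) a)).

Lemma vb_finvP : mutually_inverse (vb_f Y) vb_finv.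
Proof. unfold vb_finv; now destruct constructive_indefinite_description. Qed.
Lemma vb_RinvP : mutually_inverse (vb_R Y) vb_Rinv.
Proof. unfold vb_Rinv; now destruct constructive_indefinite_description. Qed.
Lemma vb_lsolP x z :
  unique (fun y => fst (vb_R Y (x, y)) = z) (vb_lsol x z).
Proof. unfold vb_lsol; now destruct constructive_indefinite_description. Qed.
Lemma vb_rsolP y w :
  unique (fun x => snd (vb_R Y (x, y)) = w) (vb_rsol y w).
Proof. unfold vb_rsol; now destruct constructive_indefinite_description. Qed.
Lemma vb_fixP a : unique (fun x => vb_R Y (x, a) = (x, a)) (vb_fix a).
Proof. unfold vb_fix; now destruct constructive_indefinite_description. Qed.

Definition vb_op1 (o : unop) : Y -> Y :=
  match o with Of => vb_f Y | Ofinv => vb_finv | Ofix => vb_fix end.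

Definition vb_op2 (o : binop) (x y : Y) : Y :=
  match o with
  | OR1 => fst (vb_R Y (x, y))
  | OR2 => snd (vb_R Y (x, y))
  | ORinv1 => fst (vb_Rinv (x, y))
  | ORinv2 => snd (vb_Rinv (x, y))
  | Olsol => vb_lsol x y
  | Orsol => vb_rsol x y
  end.

Fixpoint eval {S : Type} (iota : S -> Y) (t : term S) : Y :=
  match t with
  | gen s => iota s
  | app1 o t => vb_op1 o (eval iota t)
  | app2 o t u => vb_op2 o (eval iota t) (eval iota u)
  end.

Lemma eval_cong {S : Type} (rel : term S -> term S -> Prop) (iota : S -> Y) :
  (forall t u, rel t u -> eval iota t = eval iota u) ->
  forall t u, cong rel t u -> eval iota t = eval iota u.
Proof.
intros Hrel t u H.
assert (YB : forall a b c,
  R_id (vb_R Y) (id_R (vb_R Y) (R_id (vb_R Y) (a, b, c)))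
  = id_R (vb_R Y) (R_id (vb_R Y) (id_R (vb_R Y) (a, b, c)))).
{ intros a b c; apply (bq_yang_baxter _ _ (vb_biquandle Y)). }
assert (Hf : forall x y, vb_f Y (fst (vb_R Y (x, y))) = fst (vb_R Y (vb_f Y x, vb_f Y y)) /\
                         vb_f Y (snd (vb_R Y (x, y))) = snd (vb_R Y (vb_f Y x, vb_f Y y))).
{ intros x y; generalize (vb_f_hom Y (x, y)); unfold pair_map; simpl.
  intros E; rewrite <- E; now split. }
destruct vb_RinvP as [RI IR].
destruct vb_finvP as [FI IF].
induction H; simpl; try congruence; auto.
- destruct t as [[a b] c]; specialize (YB (eval iota a) (eval iota b) (eval iota c)).
  unfold R_id, id_R in YB |- *; simpl in *; congruence.
- destruct t as [[a b] c]; specialize (YB (eval iota a) (eval iota b) (eval iota c)).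
  unfold R_id, id_R in YB |- *; simpl in *; congruence.
- destruct t as [[a b] c]; specialize (YB (eval iota a) (eval iota b) (eval iota c)).
  unfold R_id, id_R in YB |- *; simpl in *; congruence.
- rewrite <- surjective_pairing, RI; reflexivity.
- rewrite <- surjective_pairing, RI; reflexivity.
- rewrite <- surjective_pairing, IR; reflexivity.
- rewrite <- surjective_pairing, IR; reflexivity.
- apply (vb_lsolP (eval iota x) (eval iota z)).
- now apply (vb_lsolP (eval iota x)).
- apply (vb_rsolP (eval iota y) (eval iota w)).
- now apply (vb_rsolP (eval iota y)).
- now rewrite (proj1 (vb_fixP (eval iota a))).
- now rewrite (proj1 (vb_fixP (eval iota a))).
- apply Hf.
- apply Hf.
Qed.

End Operations.

Lemma vb_hom_op1 (X Y : virtual_biquandle) (phi : X -> Y) : is_vb_hom X Y phi ->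
  forall o x, phi (vb_op1 X o x) = vb_op1 Y o (phi x).
Proof.
intros [HR Hf] [| |] x; simpl; auto.
- rewrite <- (proj1 (vb_finvP Y) (phi _)), <- Hf.
  now rewrite (proj2 (vb_finvP X)).
- symmetry; apply (vb_fixP Y).
  generalize (HR (vb_fix X x, x)); rewrite (proj1 (vb_fixP X x)).
  unfold pair_map; simpl; now intros <-.
Qed.

Lemma vb_hom_op2 (X Y : virtual_biquandle) (phi : X -> Y) : is_vb_hom X Y phi ->
  forall o x y, phi (vb_op2 X o x y) = vb_op2 Y o (phi x) (phi y).
Proof.
intros [HR Hf] o x y.
assert (HI : pair_map phi (vb_Rinv X (x, y)) = vb_Rinv Y (phi x, phi y)).
{ rewrite <- (proj1 (vb_RinvP Y) (pair_map phi _)), <- HR.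
  now rewrite (proj2 (vb_RinvP X)). }
destruct o; simpl.
- exact (f_equal fst (HR (x, y))).
- exact (f_equal snd (HR (x, y))).
- exact (f_equal fst HI).
- exact (f_equal snd HI).
- symmetry; apply (vb_lsolP Y).
  generalize (HR (x, vb_lsol X x y)); unfold pair_map at 2; simpl.
  intros <-; simpl; now rewrite (proj1 (vb_lsolP X x y)).
- symmetry; apply (vb_rsolP Y).
  generalize (HR (vb_rsol X x y, x)); unfold pair_map at 2; simpl.
  intros <-; simpl; now rewrite (proj1 (vb_rsolP X x y)).
Qed.

Theorem presented_universal (S : Type) (rel : term S -> term S -> Prop)
    (HS : inhabited S) :
  (forall t u, rel t u ->
     eval (presented rel HS) (fun s => cls rel (gen s)) t
     = eval (presented rel HS) (fun s => cls rel (gen s)) u) /\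
  forall (Y : virtual_biquandle) (iota : S -> Y),
    (forall t u, rel t u -> eval Y iota t = eval Y iota u) ->
    exists! phi : presented rel HS -> Y,
      is_vb_hom (presented rel HS) Y phi /\ forall s, phi (cls rel (gen s)) = iota s.
Proof.
set (P := presented rel HS).
set (j := fun s => cls rel (gen s) : P).
assert (Ej : forall t, eval P j t = cls rel t).
{ induction t as [s|o t IH|o t IHt u IHu]; simpl; [reflexivity| |].
  - rewrite IH; destruct o; simpl.
    + apply presented_fE.
    + rewrite <- (proj1 (vb_finvP P) (cls rel (app1 Ofinv t))); f_equal; simpl.
      rewrite presented_fE; apply cls_eq, cong_sym, cong_ffinv.
    + apply (vb_fixP P); simpl; rewrite presented_RE.
      f_equal; apply cls_eq; [apply cong_fix1|apply cong_fix2].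
  - rewrite IHt, IHu.
    assert (EI : vb_Rinv P (cls rel t, cls rel u)
                 = (cls rel (app2 ORinv1 t u), cls rel (app2 ORinv2 t u))).
    { assert (E : presented_R rel
                    (cls rel (app2 ORinv1 t u), cls rel (app2 ORinv2 t u))
                  = (cls rel t, cls rel u)).
      { rewrite presented_RE; f_equal; apply cls_eq.
        - exact (cong_RRinv1 rel (t, u)).
        - exact (cong_RRinv2 rel (t, u)). }
      rewrite <- E; apply (proj1 (vb_RinvP P)). }
    destruct o; simpl.
    + exact (f_equal fst (presented_RE rel t u)).
    + exact (f_equal snd (presented_RE rel t u)).
    + now rewrite EI.
    + now rewrite EI.
    + apply (vb_lsolP P); refine (eq_trans (f_equal fst (presented_RE _ _ _)) _).
      apply cls_eq, cong_lsol.
    + apply (vb_rsolP P); refine (eq_trans (f_equal snd (presented_RE _ _ _)) _).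
      apply cls_eq, cong_rsol. }
split.
{ intros t u H; fold j P; rewrite !Ej; now apply cls_eq, cong_rel. }
intros Y iota Hrel.
assert (Eph : forall t, eval Y iota (repr rel (cls rel t)) = eval Y iota t).
{ intros t; apply (eval_cong Y rel iota Hrel), repr_cls. }
exists (fun c => eval Y iota (repr rel c)); split; [split; [split|]|].
- intros [x y]; revert x y; refine (cls_ind _ _ _); intros x;
  refine (cls_ind _ _ _); intros y; simpl.
  rewrite presented_RE; unfold pair_map; simpl; rewrite !Eph; simpl.
  now rewrite <- surjective_pairing.
- refine (cls_ind _ _ _); intros x; simpl; now rewrite presented_fE, !Eph.
- intros s; now rewrite Eph.
- intros psi [Hpsi Es].
  assert (E : forall t, psi (cls rel t) = eval Y iota t).
  { intros t; rewrite <- Ej.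
    induction t as [s|o t IH|o t IHt u IHu]; simpl.
    - apply Es.
    - now rewrite vb_hom_op1, IH.
    - now rewrite vb_hom_op2, IHt, IHu. }
  apply functional_extensionality; refine (cls_ind _ _ _); intros t.
  now rewrite E, Eph.
Qed.

Local Open Scope R_scope.

Record point := Point { px : R; py : R; pz : R }.

Definition det3 (u v w : point) : R :=
  px u * (py v * pz w - pz v * py w)
  - py u * (px v * pz w - pz v * px w)
  + pz u * (px v * py w - py v * px w).

(** The plane is the plane [z = 0] of [R^3] seen from above, and the sphere is
    the unit sphere seen from outside. *)
Inductive surface := Plane | Sphere.

Definition on_surface (s : surface) (p : point) : Prop :=
  match s with
  | Plane => pz p = 0
  | Sphere => px p ^ 2 + py p ^ 2 + pz p ^ 2 = 1
  end.

Definition normal (s : surface) (p : point) : point :=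
  match s with Plane => Point 0 0 1 | Sphere => p end.

Definition smooth (g : R -> point) : Prop :=
  forall n t, ex_derive_n (fun u => px (g u)) n t /\
              ex_derive_n (fun u => py (g u)) n t /\
              ex_derive_n (fun u => pz (g u)) n t.

Definition velocity (g : R -> point) (t : R) : point :=
  Point (Derive (fun u => px (g u)) t)
        (Derive (fun u => py (g u)) t)
        (Derive (fun u => pz (g u)) t).

(** [(i, t)] stands for the point [t mod 1] of the [i]-th circle [R/Z]. *)
Definition param (n : nat) : Type := (Fin.t n * R)%type.

Definition same_param {n} (p q : param n) : Prop :=
  fst p = fst q /\ exists k : Z, snd p = snd q + IZR k.

Definition curve_at {n} (gamma : Fin.t n -> R -> point) (p : param n) : point :=
  gamma (fst p) (snd p).

Definition velocity_at {n} (gamma : Fin.t n -> R -> point) (p : param n) : point :=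
  velocity (gamma (fst p)) (snd p).

(** [p] and [q] are the two preimages of a double point. *)
Definition double_pair {n} (gamma : Fin.t n -> R -> point) (p q : param n) : Prop :=
  curve_at gamma p = curve_at gamma q /\ ~ same_param p q.

Inductive strand := Over | Under | Virtual.

Definition opposite (a : strand) : strand :=
  match a with Over => Under | Under => Over | Virtual => Virtual end.

Record diagram := {
  dsurf : surface;
  dsize : nat;
  dsize_pos : (0 < dsize)%nat;
  dcurve : Fin.t dsize -> R -> point;
  dcurve_periodic : forall i t, dcurve i (t + 1) = dcurve i t;
  dcurve_on : forall i t, on_surface dsurf (dcurve i t);
  dcurve_smooth : forall i, smooth (dcurve i);
  dcurve_immersion : forall i t, velocity (dcurve i) t <> Point 0 0 0;
  dcurve_transverse : forall p q, double_pair dcurve p q ->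
    det3 (velocity_at dcurve p) (velocity_at dcurve q)
         (normal dsurf (curve_at dcurve p)) <> 0;
  dcurve_no_triple : forall p q r,
    double_pair dcurve p q -> double_pair dcurve p r -> same_param q r;
  dcurve_finite : exists l : list (param dsize), forall p q,
    double_pair dcurve p q -> exists r, In r l /\ same_param p r;
  (** The values of [dstrand] away from the double points are irrelevant. *)
  dstrand : param dsize -> strand;
  dstrand_periodic : forall p q, same_param p q -> dstrand p = dstrand q;
  dstrand_opposite : forall p q,
    double_pair dcurve p q -> dstrand q = opposite (dstrand p)
}.

Section Semiarcs.
Context (D : diagram).

Definition double (p : param (dsize D)) : Prop :=
  exists q, double_pair (dcurve D) p q.

(** [p] and [q] are joined by an arc of their circle, possibly winding around
    it, that contains no preimage of a double point. *)
Definition joined (p q : param (dsize D)) : Prop :=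
  fst p = fst q /\ exists k : Z, forall r : R,
    Rmin (snd p) (snd q + IZR k) <= r <= Rmax (snd p) (snd q + IZR k) ->
    ~ double (fst p, r).

(** Semiarcs are the components of the complement in the circles of the
    preimages of the double points. *)
Definition semiarc : Type :=
  {A : param (dsize D) -> Prop | exists p, ~ double p /\ forall q, A q <-> joined p q}.

Definition on_semiarc (a : semiarc) (p : param (dsize D)) : Prop := proj1_sig a p.

Definition ends_at (a : semiarc) (p : param (dsize D)) : Prop :=
  exists eps, 0 < eps /\ forall h, 0 < h < eps -> on_semiarc a (fst p, snd p - h).

Definition starts_at (a : semiarc) (p : param (dsize D)) : Prop :=
  exists eps, 0 < eps /\ forall h, 0 < h < eps -> on_semiarc a (fst p, snd p + h).

(** When both strands point downward, the strand [p] runs from top-left to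
    bottom-right and the strand [q] from top-right to bottom-left: [q] crosses
    [p] clockwise, whence the sign of the determinant. *)
Definition crossing (p q : param (dsize D)) (x y z w : semiarc) : Prop :=
  double_pair (dcurve D) p q /\
  det3 (velocity_at (dcurve D) p) (velocity_at (dcurve D) q)
       (normal (dsurf D) (curve_at (dcurve D) p)) < 0 /\
  ends_at x p /\ starts_at w p /\ ends_at y q /\ starts_at z q.

Inductive crossing_kind := Positive | Negative | VirtualCrossing.

Definition kind (p q : param (dsize D)) : crossing_kind :=
  match dstrand D q with
  | Over => Positive
  | Under => Negative
  | Virtual => VirtualCrossing
  end.

Lemma avoid_translates (l : list R) (a b : R) : a < b ->
  exists a' b', a <= a' /\ a' < b' /\ b' <= b /\
    forall t r k, a' < t < b' -> In r l -> t <> r + IZR k.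
Proof.
intros Hab; induction l as [|r0 l IH].
- exists a, b; repeat split; try lra; intros t r k _ [].
- destruct IH as (a1 & b1 & H1 & H2 & H3 & H4).
  destruct (archimed (a1 - r0)) as [U1 U2].
  set (m := up (a1 - r0)) in *.
  exists a1, (Rmin b1 (r0 + IZR m)).
  assert (Hl := Rmin_l b1 (r0 + IZR m)); assert (Hr := Rmin_r b1 (r0 + IZR m)).
  repeat split; try lra.
  + apply Rmin_glb_lt; lra.
  + intros t r k Ht [<-|Hr0]; [|apply H4; [lra|assumption]].
    intros E.
    assert (K1 : IZR k < IZR m) by lra.
    assert (K2 : IZR (m - 1) < IZR k) by (rewrite minus_IZR; lra).
    apply lt_IZR in K1; apply lt_IZR in K2; lia.
Qed.

Lemma semiarc_inhabited : inhabited semiarc.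
Proof.
assert (i : Fin.t (dsize D)).
{ generalize (dsize_pos D); destruct (dsize D) as [|n]; [lia|intros _; exact Fin.F1]. }
destruct (dcurve_finite D) as [l Hl].
destruct (avoid_translates (map snd l) 0 1 ltac:(lra)) as (a & b & H1 & H2 & H3 & H4).
assert (Hp : ~ double (i, (a + b) / 2)).
{ intros [q Hq]; destruct (Hl _ _ Hq) as (r & Hr & _ & k & E); simpl in E.
  apply (H4 ((a + b) / 2) (snd r) k); [lra|now apply in_map|exact E]. }
constructor; exists (joined (i, (a + b) / 2)), (i, (a + b) / 2); split; [exact Hp|tauto].
Qed.

Inductive standard_relation : term semiarc -> term semiarc -> Prop :=
| std_positive_z p q x y z w : crossing p q x y z w -> kind p q = Positive ->
    standard_relation (gen z) (app2 OR1 (gen x) (gen y))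
| std_positive_w p q x y z w : crossing p q x y z w -> kind p q = Positive ->
    standard_relation (gen w) (app2 OR2 (gen x) (gen y))
| std_negative_z p q x y z w : crossing p q x y z w -> kind p q = Negative ->
    standard_relation (gen z) (app2 ORinv1 (gen x) (gen y))
| std_negative_w p q x y z w : crossing p q x y z w -> kind p q = Negative ->
    standard_relation (gen w) (app2 ORinv2 (gen x) (gen y))
| std_virtual_z p q x y z w : crossing p q x y z w -> kind p q = VirtualCrossing ->
    standard_relation (gen z) (app1 Ofinv (gen y))
| std_virtual_w p q x y z w : crossing p q x y z w -> kind p q = VirtualCrossing ->
    standard_relation (gen w) (app1 Of (gen x)).

Inductive new_relation : term semiarc -> term semiarc -> Prop :=
| new_positive_z p q x y z w : crossing p q x y z w -> kind p q = Positive ->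
    new_relation (gen z) (app2 OR1 (gen x) (app1 Of (gen y)))
| new_positive_w p q x y z w : crossing p q x y z w -> kind p q = Positive ->
    new_relation (gen w) (app2 OR2 (app1 Ofinv (gen x)) (gen y))
| new_negative_z p q x y z w : crossing p q x y z w -> kind p q = Negative ->
    new_relation (gen z) (app2 ORinv1 (gen x) (app1 Of (gen y)))
| new_negative_w p q x y z w : crossing p q x y z w -> kind p q = Negative ->
    new_relation (gen w) (app2 ORinv2 (app1 Ofinv (gen x)) (gen y))
| new_virtual_z p q x y z w : crossing p q x y z w -> kind p q = VirtualCrossing ->
    new_relation (gen z) (gen y)
| new_virtual_w p q x y z w : crossing p q x y z w -> kind p q = VirtualCrossing ->
    new_relation (gen w) (gen x).

Definition VBQ : virtual_biquandle := presented standard_relation semiarc_inhabited.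

Definition newVBQ : virtual_biquandle := presented new_relation semiarc_inhabited.

End Semiarcs.

(* Main.v *)
Require Import Defs.
From Stdlib Require Import Reals ZArith Lra Lia Classical ClassicalEpsilon
  FunctionalExtensionality.
From Stdlib Require Fin.
From Coquelicot Require Import Coquelicot.

(** Suppose the semiarcs carry integers [n] with [n z = n x], [n w = n y] and
    [n x = n y + 1] at every crossing (an Alexander numbering).  Then
    [a |-> f^(n a) a] exchanges the standard and the new crossing relations,
    because [f] commutes with [R], and its inverse is [a |-> f^(- n a) a].

    Such a numbering exists because the diagram lies in the plane or the sphere.
    Integrate along all components [c] of the diagram the form
    [det3 (N P) (c t - P) (c' t) / |c t - P|^2 dt], where [N] is the normal.  In
    the plane this is the angle form seen from [P].  As a function of a point [P]
    running along the diagram itself, the integral converges.  It is constant on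
    every semiarc, since the kernel is the [dt] part of a closed form on the
    product of two components, and it jumps by [2 PI] across each double point.
    Rounding it down after division by [- 2 PI] yields [n]; the integral need
    not be a multiple of [PI], so the sphere requires no choice of a base point. *)

(** * Powers of [f] and the isomorphism attached to a numbering *)

(** Placing [P] on the diagram ties the numbering to the semiarcs themselves, so the regions of the
    complement never enter. The price is a quotient [0/0] where [P] meets its own component. There
    [c t - P] and [c' t] are parallel to first order, so the numerator vanishes to second order like
    the denominator, and the immersion condition keeps the quotient bounded.

    At a double point the integral has a definite value [I], and its one-sided limits along either
    strand are [I + PI] and [I - PI]. Both strands pass through the same point, so all four semiarcs
    are compared through the single number [I]; this gives [n z = n x] and [n w = n y] together with
    the difference of one.

    On the sphere the form is not closed in [x] alone: its differential is a constant multiple of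
    the area form. What survives is a symmetry under exchange of [P] and [x]: the variation of the
    form as [P] moves is the total derivative of the form with the two points exchanged, and total
    derivatives integrate to zero around a circle. *)

Lemma is_vb_hom_id (Y : virtual_biquandle) : is_vb_hom Y Y (fun y => y).
Proof.
split; [|reflexivity].
intros p; unfold pair_map; now rewrite <- !surjective_pairing.
Qed.

Section Powers.
Context (Y : virtual_biquandle).
Local Open Scope Z_scope.

(** At most one of the two iterations is non-trivial, because [Z.to_nat] sends negative integers to
    0. *)
Definition fpow (n : Z) (y : Y) : Y :=
  Nat.iter (Z.to_nat n) (vb_f Y) (Nat.iter (Z.to_nat (- n)) (vb_finv Y) y).

Lemma fpow_succ n y : fpow (n + 1) y = vb_f Y (fpow n y).
Proof.
unfold fpow; destruct (Z.le_gt_cases 0 n) as [Hn|Hn].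
- replace (Z.to_nat (n + 1)) with (S (Z.to_nat n)) by lia.
  replace (Z.to_nat (- (n + 1))) with O by lia.
  now replace (Z.to_nat (- n)) with O by lia.
- replace (Z.to_nat (n + 1)) with O by lia.
  replace (Z.to_nat n) with O by lia.
  replace (Z.to_nat (- n)) with (S (Z.to_nat (- (n + 1)))) by lia.
  simpl; now rewrite (proj2 (vb_finvP Y)).
Qed.

Lemma fpow_pred n y : fpow (n - 1) y = vb_finv Y (fpow n y).
Proof.
rewrite <- (proj1 (vb_finvP Y) (fpow (n - 1) y)), <- fpow_succ.
now replace (n - 1 + 1) with n by lia.
Qed.

Lemma vb_f_is_hom : is_vb_hom Y Y (vb_f Y).
Proof. split; [apply vb_f_hom|reflexivity]. Qed.

Lemma vb_finv_is_hom : is_vb_hom Y Y (vb_finv Y).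
Proof.
split.
- intros p; generalize (vb_f_hom Y (pair_map (vb_finv Y) p)); unfold pair_map; simpl.
  rewrite !(proj2 (vb_finvP Y)), <- surjective_pairing; intros <-; simpl.
  now rewrite !(proj1 (vb_finvP Y)), <- surjective_pairing.
- intros x; rewrite (proj1 (vb_finvP Y)); symmetry; apply (proj2 (vb_finvP Y)).
Qed.

Lemma fpow_is_hom n : is_vb_hom Y Y (fpow n).
Proof.
assert (I : forall (g : Y -> Y) k, is_vb_hom Y Y g -> is_vb_hom Y Y (Nat.iter k g)).
{ intros g k [HR Hf]; induction k as [|k [IR If]]; [apply is_vb_hom_id|].
  split.
  - intros p; simpl; specialize (IR p); apply (f_equal (pair_map g)) in IR.
    rewrite HR in IR; exact IR.
  - intros x; simpl; now rewrite If, Hf. }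
destruct (I _ (Z.to_nat n) vb_f_is_hom) as [HR Hf].
destruct (I _ (Z.to_nat (- n)) vb_finv_is_hom) as [KR Kf].
split.
- intros p; specialize (KR p); apply (f_equal (pair_map (Nat.iter (Z.to_nat n) (vb_f Y)))) in KR.
  rewrite HR in KR; exact KR.
- intros x; unfold fpow; now rewrite Kf, Hf.
Qed.

Lemma fpow_opp n y : fpow (- n) (fpow n y) = y.
Proof.
revert n; apply Z.bi_induction.
- now intros a b ->.
- reflexivity.
- intros n; replace (- Z.succ n) with (- n - 1) by lia.
  change (Z.succ n) with (n + 1).
  rewrite fpow_pred, fpow_succ, (proj2 (fpow_is_hom _)), (proj1 (vb_finvP Y)).
  split; auto.
Qed.

End Powers.

Lemma fpow_hom (X Y : virtual_biquandle) (phi : X -> Y) : is_vb_hom X Y phi ->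
  forall n x, phi (fpow X n x) = fpow Y n (phi x).
Proof.
intros Hphi.
apply (Z.bi_induction (fun n => forall x, phi (fpow X n x) = fpow Y n (phi x))).
- now intros a b ->.
- reflexivity.
- intros n; change (Z.succ n) with (n + 1)%Z; split; intros H x.
  + now rewrite !fpow_succ, (proj2 Hphi), H.
  + specialize (H x); rewrite !fpow_succ, (proj2 Hphi) in H.
    apply (f_equal (vb_finv Y)) in H; now rewrite !(proj1 (vb_finvP Y)) in H.
Qed.

Lemma is_vb_hom_comp (X Y Z : virtual_biquandle) (phi : X -> Y) (psi : Y -> Z) :
  is_vb_hom X Y phi -> is_vb_hom Y Z psi -> is_vb_hom X Z (fun x => psi (phi x)).
Proof.
intros [HR Hf] [KR Kf]; split.
- intros p; exact (eq_trans (f_equal (pair_map psi) (HR p)) (KR (pair_map phi p))).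
- intros x; now rewrite Hf, Kf.
Qed.

(** Uniqueness in the universal property: [phi] and the identity extend the same map on
    generators. *)
Lemma presented_hom_id (S : Type) (rel : term S -> term S -> Prop) (HS : inhabited S)
    (phi : presented rel HS -> presented rel HS) :
  is_vb_hom _ _ phi -> (forall s, phi (cls rel (gen s)) = cls rel (gen s)) ->
  forall x, phi x = x.
Proof.
intros Hphi Hgen x; destruct (presented_universal S rel HS) as [Hrel U].
destruct (U _ _ Hrel) as [chi [_ Hchi]].
rewrite <- (Hchi phi (conj Hphi Hgen)).
now rewrite (Hchi (fun x => x)); [|split; [apply is_vb_hom_id|]].
Qed.

Definition alexander_numbering (D : diagram) (n : semiarc D -> Z) : Prop :=
  forall p q x y z w, crossing D p q x y z w ->
    n z = n x /\ n w = n y /\ n x = (n y + 1)%Z.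

Section Isomorphism.
Context (D : diagram) (n : semiarc D -> Z) (Hn : alexander_numbering D n).

(** At a classical crossing the exponent of the outgoing label distributes over [R]. For [z] it is
    [n x = n y + 1]: right for [x] and one too large for [y], and the surplus is the [f'] of the new
    relation. For [w] it is [n y = n x - 1]: right for [y] and one too small for [x], which is the
    [f'^{-1}]. At a virtual crossing the same differences cancel the [f^{-1}] and [f] of the
    standard relation. *)
Lemma new_to_standard : exists phi : newVBQ D -> VBQ D,
  is_vb_hom _ _ phi /\
  forall a, phi (cls _ (gen a)) = fpow (VBQ D) (n a) (cls _ (gen a)).
Proof.
destruct (presented_universal _ (new_relation D) (semiarc_inhabited D)) as [_ U].
destruct (U (VBQ D) (fun a => fpow (VBQ D) (n a) (cls _ (gen a)))) as [phi [H _]];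
  [|now exists phi].
destruct (presented_universal _ (standard_relation D) (semiarc_inhabited D)) as [V _].
fold (VBQ D) in V.
assert (P2 := fun k => vb_hom_op2 _ _ _ (fpow_is_hom (VBQ D) k)).
intros t u []; destruct (Hn _ _ _ _ _ _ H) as (E1 & E2 & E3); cbn [eval].
- generalize (V _ _ (std_positive_z D _ _ _ _ _ _ H H0)); cbn [eval]; intros ->.
  change (vb_op1 (VBQ D) Of) with (vb_f (VBQ D)).
  rewrite P2, <- fpow_succ; now rewrite E1, E3.
- generalize (V _ _ (std_positive_w D _ _ _ _ _ _ H H0)); cbn [eval]; intros ->.
  change (vb_op1 (VBQ D) Ofinv) with (vb_finv (VBQ D)).
  rewrite P2, <- fpow_pred, E2; do 2 f_equal; lia.
- generalize (V _ _ (std_negative_z D _ _ _ _ _ _ H H0)); cbn [eval]; intros ->.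
  change (vb_op1 (VBQ D) Of) with (vb_f (VBQ D)).
  rewrite P2, <- fpow_succ; now rewrite E1, E3.
- generalize (V _ _ (std_negative_w D _ _ _ _ _ _ H H0)); cbn [eval]; intros ->.
  change (vb_op1 (VBQ D) Ofinv) with (vb_finv (VBQ D)).
  rewrite P2, <- fpow_pred, E2; do 2 f_equal; lia.
- generalize (V _ _ (std_virtual_z D _ _ _ _ _ _ H H0)); cbn [eval]; intros ->.
  rewrite (vb_hom_op1 _ _ _ (fpow_is_hom _ _)).
  change (vb_op1 (VBQ D) Ofinv) with (vb_finv (VBQ D)).
  rewrite <- fpow_pred; f_equal; lia.
- generalize (V _ _ (std_virtual_w D _ _ _ _ _ _ H H0)); cbn [eval]; intros ->.
  rewrite (vb_hom_op1 _ _ _ (fpow_is_hom _ _)).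
  change (vb_op1 (VBQ D) Of) with (vb_f (VBQ D)).
  rewrite <- fpow_succ; f_equal; lia.
Qed.

Lemma standard_to_new : exists psi : VBQ D -> newVBQ D,
  is_vb_hom _ _ psi /\
  forall a, psi (cls _ (gen a)) = fpow (newVBQ D) (- n a) (cls _ (gen a)).
Proof.
destruct (presented_universal _ (standard_relation D) (semiarc_inhabited D)) as [_ U].
destruct (U (newVBQ D) (fun a => fpow (newVBQ D) (- n a) (cls _ (gen a)))) as [psi [H _]];
  [|now exists psi].
destruct (presented_universal _ (new_relation D) (semiarc_inhabited D)) as [V _].
fold (newVBQ D) in V.
assert (P2 := fun k => vb_hom_op2 _ _ _ (fpow_is_hom (newVBQ D) k)).
assert (P1 := fun k => vb_hom_op1 _ _ _ (fpow_is_hom (newVBQ D) k)).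
intros t u []; destruct (Hn _ _ _ _ _ _ H) as (E1 & E2 & E3); cbn [eval].
- generalize (V _ _ (new_positive_z D _ _ _ _ _ _ H H0)); cbn [eval]; intros ->.
  rewrite P2, P1; change (vb_op1 (newVBQ D) Of) with (vb_f (newVBQ D)).
  rewrite <- fpow_succ, E1; do 2 f_equal; lia.
- generalize (V _ _ (new_positive_w D _ _ _ _ _ _ H H0)); cbn [eval]; intros ->.
  rewrite P2, P1; change (vb_op1 (newVBQ D) Ofinv) with (vb_finv (newVBQ D)).
  rewrite <- fpow_pred, E2; do 2 f_equal; lia.
- generalize (V _ _ (new_negative_z D _ _ _ _ _ _ H H0)); cbn [eval]; intros ->.
  rewrite P2, P1; change (vb_op1 (newVBQ D) Of) with (vb_f (newVBQ D)).
  rewrite <- fpow_succ, E1; do 2 f_equal; lia.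
- generalize (V _ _ (new_negative_w D _ _ _ _ _ _ H H0)); cbn [eval]; intros ->.
  rewrite P2, P1; change (vb_op1 (newVBQ D) Ofinv) with (vb_finv (newVBQ D)).
  rewrite <- fpow_pred, E2; do 2 f_equal; lia.
- generalize (V _ _ (new_virtual_z D _ _ _ _ _ _ H H0)); cbn [eval]; intros ->.
  change (vb_op1 (newVBQ D) Ofinv) with (vb_finv (newVBQ D)).
  rewrite <- fpow_pred; f_equal; lia.
- generalize (V _ _ (new_virtual_w D _ _ _ _ _ _ H H0)); cbn [eval]; intros ->.
  change (vb_op1 (newVBQ D) Of) with (vb_f (newVBQ D)).
  rewrite <- fpow_succ; f_equal; lia.
Qed.

Lemma isomorphic_of_numbering : vb_isomorphic (newVBQ D) (VBQ D).
Proof.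
destruct new_to_standard as (phi & Hphi & Gphi).
destruct standard_to_new as (psi & Hpsi & Gpsi).
assert (E : forall x, psi (phi x) = x).
{ apply presented_hom_id.
  - exact (is_vb_hom_comp _ _ _ _ _ Hphi Hpsi).
  - intros a; rewrite Gphi, (fpow_hom _ _ _ Hpsi), Gpsi.
    rewrite <- (Z.opp_involutive (n a)) at 1; apply fpow_opp. }
assert (F : forall y, phi (psi y) = y).
{ apply presented_hom_id.
  - exact (is_vb_hom_comp _ _ _ _ _ Hpsi Hphi).
  - intros a; rewrite Gpsi, (fpow_hom _ _ _ Hphi), Gphi; apply fpow_opp. }
exists phi; split; [exact Hphi|].
intros y; exists (psi y); split; [apply F|].
intros x <-; apply E.
Qed.

End Isomorphism.

Local Open Scope R_scope.

(** * Calculus of point-valued functions *)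

Definition psub (p q : point) : point := Point (px p - px q) (py p - py q) (pz p - pz q).
Definition dot (p q : point) : R := px p * px q + py p * py q + pz p * pz q.

Lemma dot_pos p : p <> Point 0 0 0 -> 0 < dot p p.
Proof.
destruct p as [x y z]; unfold dot; simpl; intros H.
destruct (Req_dec x 0) as [->|]; [destruct (Req_dec y 0) as [->|]; [destruct (Req_dec z 0) as [->|]|]|];
  [easy|nra..].
Qed.

Lemma psub_eq0 p q : psub p q = Point 0 0 0 -> p = q.
Proof.
destruct p, q; unfold psub; simpl; intros H; injection H; intros; f_equal; lra.
Qed.

Lemma dot_psub_neq p q : p <> q -> dot (psub p q) (psub p q) <> 0.
Proof. intros H; apply Rgt_not_eq, dot_pos; intros E; now apply H, psub_eq0. Qed.

Lemma is_derive_plus_R (f g : R -> R) (t a b : R) : is_derive f t a -> is_derive g t b ->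
  is_derive (fun x => f x + g x) t (a + b).
Proof. exact (is_derive_plus f g t a b). Qed.

Lemma is_derive_minus_R (f g : R -> R) (t a b : R) : is_derive f t a -> is_derive g t b ->
  is_derive (fun x => f x - g x) t (a - b).
Proof. exact (is_derive_minus f g t a b). Qed.

Lemma is_derive_mult_R (f g : R -> R) (t a b : R) : is_derive f t a -> is_derive g t b ->
  is_derive (fun x => f x * g x) t (a * g t + f t * b).
Proof. intros F G; exact (is_derive_mult f g t a b F G Rmult_comm). Qed.

Definition is_pderive (g : R -> point) (t : R) (v : point) : Prop :=
  is_derive (fun u => px (g u)) t (px v) /\ is_derive (fun u => py (g u)) t (py v) /\
  is_derive (fun u => pz (g u)) t (pz v).

Definition pcontinuous (g : R -> point) (t : R) : Prop :=
  continuity_pt (fun u => px (g u)) t /\ continuity_pt (fun u => py (g u)) t /\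
  continuity_pt (fun u => pz (g u)) t.

Definition pcontinuous_2d (g : R -> R -> point) (s t : R) : Prop :=
  continuity_2d_pt (fun u v => px (g u v)) s t /\
  continuity_2d_pt (fun u v => py (g u v)) s t /\
  continuity_2d_pt (fun u v => pz (g u v)) s t.

Lemma is_derive_continuity_pt (f : R -> R) t l : is_derive f t l -> continuity_pt f t.
Proof.
intros H; apply derivable_continuous_pt; exists l; now apply is_derive_Reals.
Qed.

Lemma is_pderive_continuous g t v : is_pderive g t v -> pcontinuous g t.
Proof. intros (H & K & L); split; [|split]; eapply is_derive_continuity_pt; eassumption. Qed.

Lemma is_pderive_psub g h t v w : is_pderive g t v -> is_pderive h t w ->
  is_pderive (fun u => psub (g u) (h u)) t (psub v w).
Proof.
intros (H & K & L) (H' & K' & L'); split; [|split]; simpl;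
  apply is_derive_minus_R; assumption.
Qed.

Lemma is_pderive_comp_plus g (s t : R) v : is_pderive g (s + t) v ->
  is_pderive (fun u => g (u + t)) s v /\ is_pderive (fun u => g (s + u)) t v.
Proof.
assert (A : forall (f : R -> R) (l : R), is_derive f (s + t) l ->
  is_derive (fun u => f (u + t)) s l /\ is_derive (fun u => f (s + u)) t l).
{ intros f l H; split.
  - replace l with (scal 1 l) by (unfold scal; simpl; unfold mult; simpl; ring).
    apply (is_derive_comp f (fun u => u + t)); [exact H|auto_derive; trivial; ring].
  - replace l with (scal 1 l) by (unfold scal; simpl; unfold mult; simpl; ring).
    apply (is_derive_comp f (fun u => s + u)); [exact H|auto_derive; trivial; ring]. }
intros (H & K & L); apply A in H; apply A in K; apply A in L; unfold is_pderive; tauto.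
Qed.

Lemma is_derive_det3 f g h t u v w : is_pderive f t u -> is_pderive g t v -> is_pderive h t w ->
  is_derive (fun x => det3 (f x) (g x) (h x)) t
    (det3 u (g t) (h t) + det3 (f t) v (h t) + det3 (f t) (g t) w).
Proof.
intros (F1 & F2 & F3) (G1 & G2 & G3) (H1 & H2 & H3); unfold det3.
evar_last.
- apply is_derive_plus_R; [apply is_derive_minus_R|]; apply is_derive_mult_R; try eassumption;
  apply is_derive_minus_R; apply is_derive_mult_R; eassumption.
- simpl; ring.
Qed.

Lemma is_derive_dot f g t u v : is_pderive f t u -> is_pderive g t v ->
  is_derive (fun x => dot (f x) (g x)) t (dot u (g t) + dot (f t) v).
Proof.
intros (F1 & F2 & F3) (G1 & G2 & G3); unfold dot.
evar_last.
- apply is_derive_plus_R; [apply is_derive_plus_R|]; apply is_derive_mult_R; eassumption.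
- simpl; ring.
Qed.

Lemma continuity_2d_det3 f g h s t :
  pcontinuous_2d f s t -> pcontinuous_2d g s t -> pcontinuous_2d h s t ->
  continuity_2d_pt (fun u v => det3 (f u v) (g u v) (h u v)) s t.
Proof.
intros (F1 & F2 & F3) (G1 & G2 & G3) (H1 & H2 & H3); unfold det3.
apply continuity_2d_pt_plus; [apply continuity_2d_pt_minus|]; apply continuity_2d_pt_mult; trivial;
apply continuity_2d_pt_minus; apply continuity_2d_pt_mult; trivial.
Qed.

Lemma continuity_2d_dot f g s t :
  pcontinuous_2d f s t -> pcontinuous_2d g s t ->
  continuity_2d_pt (fun u v => dot (f u v) (g u v)) s t.
Proof.
intros (F1 & F2 & F3) (G1 & G2 & G3); unfold dot.
apply continuity_2d_pt_plus; [apply continuity_2d_pt_plus|]; apply continuity_2d_pt_mult; trivial.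
Qed.

Lemma continuity_2d_div f g s t : continuity_2d_pt f s t -> continuity_2d_pt g s t ->
  g s t <> 0 -> continuity_2d_pt (fun u v => f u v / g u v) s t.
Proof. intros; apply continuity_2d_pt_mult; trivial; now apply continuity_2d_pt_inv. Qed.

Lemma pcontinuous_2d_psub f g s t : pcontinuous_2d f s t -> pcontinuous_2d g s t ->
  pcontinuous_2d (fun u v => psub (f u v) (g u v)) s t.
Proof.
intros (F1 & F2 & F3) (G1 & G2 & G3); split; [|split]; simpl;
now apply continuity_2d_pt_minus.
Qed.

Lemma pcontinuous_2d_comp g (f : R -> R -> R) s t : pcontinuous g (f s t) ->
  continuity_2d_pt f s t -> pcontinuous_2d (fun u v => g (f u v)) s t.
Proof.
intros (G1 & G2 & G3) F; split; [|split];
  [apply (continuity_1d_2d_pt_comp (fun u => px (g u)))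
  |apply (continuity_1d_2d_pt_comp (fun u => py (g u)))
  |apply (continuity_1d_2d_pt_comp (fun u => pz (g u)))]; trivial.
Qed.

Lemma pcontinuous_2d_l g s t : pcontinuous g s -> pcontinuous_2d (fun u _ => g u) s t.
Proof. intros H; apply (pcontinuous_2d_comp g (fun u _ => u)); [exact H|apply continuity_2d_pt_id1]. Qed.
Lemma pcontinuous_2d_r g s t : pcontinuous g t -> pcontinuous_2d (fun _ v => g v) s t.
Proof. intros H; apply (pcontinuous_2d_comp g (fun _ v => v)); [exact H|apply continuity_2d_pt_id2]. Qed.

Lemma locally_2d_swap P s t : locally_2d (fun u v => P v u) t s -> locally_2d P s t.
Proof. intros [d H]; exists d; intros; now apply H. Qed.

Lemma continuity_2d_swap (f : R -> R -> R) s t :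
  continuity_2d_pt (fun u v => f v u) t s -> continuity_2d_pt f s t.
Proof. intros H eps; apply locally_2d_swap, H. Qed.

Lemma continuity_2d_comp (f g h : R -> R -> R) s t :
  continuity_2d_pt f (g s t) (h s t) -> continuity_2d_pt g s t -> continuity_2d_pt h s t ->
  continuity_2d_pt (fun u v => f (g u v) (h u v)) s t.
Proof.
intros F G H eps; destruct (F eps) as [d Hd]; destruct (G d) as [d1 H1], (H d) as [d2 H2].
exists (mkposreal (Rmin d1 d2) (Rmin_stable_in_posreal d1 d2)); simpl; intros u v Hu Hv.
assert (A := Rmin_l d1 d2); assert (B := Rmin_r d1 d2).
apply Hd; [apply H1|apply H2]; lra.
Qed.

Lemma continuity_2d_section_r f s t : continuity_2d_pt f s t -> continuity_pt (fun v => f s v) t.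
Proof.
intros F; apply continuity_pt_filterlim, filterlim_locally; intros eps.
apply (locally_2d_1d_const_x _ s t (F eps)).
Qed.

Lemma ex_derive_n_Derive f n t : ex_derive_n f (S n) t -> ex_derive_n (Derive f) n t.
Proof.
destruct n as [|n]; [easy|]; simpl; apply ex_derive_ext; intros u.
change (Derive_n f (S n) u = Derive_n (Derive_n f 1) n u).
rewrite Derive_n_comp; f_equal; lia.
Qed.

Lemma smooth_velocity g : smooth g -> smooth (velocity g).
Proof.
intros H n t; destruct (H (S n) t) as (H1 & H2 & H3).
split; [|split]; now apply ex_derive_n_Derive.
Qed.

Lemma smooth_pderive g t : smooth g -> is_pderive g t (velocity g t).
Proof.
intros H; destruct (H 1%nat t) as (H1 & H2 & H3); split; [|split]; apply Derive_correct; assumption.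
Qed.

Lemma smooth_continuous g t : smooth g -> pcontinuous g t.
Proof. intros H; eapply is_pderive_continuous, smooth_pderive, H. Qed.

(** * The kernel and its continuity *)

Definition slope (f : R -> R) (s t : R) : R :=
  if Req_EM_T s t then Derive f t else (f t - f s) / (t - s).

(** The second-order Taylor coefficient at [t]: off the diagonal, [f s = f t + (s - t) f' t + (s -
    t)^2 slope2 f s t]. Hence the diagonal value [f'' t / 2]. *)
Definition slope2 (f : R -> R) (s t : R) : R :=
  if Req_EM_T s t then Derive (Derive f) t / 2 else (Derive f t - slope f s t) / (t - s).

Lemma slope_diag f t : slope f t t = Derive f t.
Proof. unfold slope; now destruct (Req_EM_T t t). Qed.

Lemma slope2_diag f t : slope2 f t t = Derive (Derive f) t / 2.
Proof. unfold slope2; now destruct (Req_EM_T t t). Qed.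

Lemma slope_spec f s t : f t - f s = (t - s) * slope f s t.
Proof. unfold slope; destruct (Req_EM_T s t) as [->|H]; [ring|field; lra]. Qed.

Lemma slope2_spec f s t : Derive f t = slope f s t + (t - s) * slope2 f s t.
Proof.
unfold slope2; destruct (Req_EM_T s t) as [->|H]; [rewrite slope_diag; ring|field; lra].
Qed.

(** By the mean value theorem [slope f u v] is a value of [f'] between [u] and [v]. *)
Lemma slope_continuous_diag f t : locally t (ex_derive f) -> continuity_pt (Derive f) t ->
  continuity_2d_pt (slope f) t t.
Proof.
intros [d1 H1] H eps; apply continuity_pt_filterlim in H.
destruct (proj1 (filterlim_locally _ _) H eps) as [d2 H2].
exists (mkposreal (Rmin d1 d2) (Rmin_stable_in_posreal d1 d2)); simpl; intros u v Hu Hv.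
assert (A := Rmin_l d1 d2); assert (B := Rmin_r d1 d2).
assert (I : forall x, Rmin u v <= x <= Rmax u v -> Rabs (x - t) < Rmin d1 d2).
{ intros x Hx; destruct (Rle_dec u v) as [K|K].
  - rewrite Rmin_left, Rmax_right in Hx by lra.
    apply Rabs_def1; [apply Rabs_def2 in Hv; lra|apply Rabs_def2 in Hu; lra].
  - rewrite Rmin_right, Rmax_left in Hx by lra.
    apply Rabs_def1; [apply Rabs_def2 in Hu; lra|apply Rabs_def2 in Hv; lra]. }
destruct (MVT_gen f u v (Derive f)) as (c & Hc & E).
- intros x Hx; apply Derive_correct, H1; specialize (I x ltac:(lra)).
  change (Rabs (x - t) < d1); lra.
- intros x Hx; eapply is_derive_continuity_pt, Derive_correct, H1; specialize (I x Hx).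
  change (Rabs (x - t) < d1); lra.
- rewrite slope_diag; specialize (I c Hc).
  assert (J : Rabs (Derive f c - Derive f t) < eps).
  { apply H2; change (Rabs (c - t) < d2); lra. }
  rewrite slope_spec in E.
  destruct (Req_dec u v) as [->|N].
  + rewrite slope_diag; apply H2; change (Rabs (v - t) < d2); lra.
  + replace (slope f u v) with (Derive f c); [exact J|].
    apply (Rmult_eq_reg_l (v - u)); lra.
Qed.

(* With [h x = f x - f v - (x - v) f' v - (L / 2) (x - v)^2] and [L = f'' t], the
   difference [slope2 f u v - L / 2] is [h u / (u - v)^2], which two applications
   of the mean value theorem bound by the oscillation of [f'']. *)
Lemma slope2_continuous_diag f t : (forall n u, ex_derive_n f n u) ->
  continuity_2d_pt (slope2 f) t t.
Proof.
intros Hf eps.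
assert (D1 : forall u, ex_derive f u) by (intros u; exact (Hf 1%nat u)).
assert (D2 : forall u, ex_derive (Derive f) u) by (intros u; exact (Hf 2%nat u)).
assert (H : continuity_pt (Derive (Derive f)) t).
{ eapply is_derive_continuity_pt, Derive_correct; exact (Hf 3%nat t). }
apply continuity_pt_filterlim in H.
destruct (proj1 (filterlim_locally _ _) H eps) as [d Hd].
exists d; intros u v Hu Hv; rewrite slope2_diag.
set (L := Derive (Derive f) t) in *.
assert (J : forall x, Rmin u v <= x <= Rmax u v -> Rabs (Derive (Derive f) x - L) < eps).
{ intros x Hx; apply Hd; change (Rabs (x - t) < d); destruct (Rle_dec u v) as [K|K].
  - rewrite Rmin_left, Rmax_right in Hx by lra.
    apply Rabs_def1; [apply Rabs_def2 in Hv; lra|apply Rabs_def2 in Hu; lra].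
  - rewrite Rmin_right, Rmax_left in Hx by lra.
    apply Rabs_def1; [apply Rabs_def2 in Hu; lra|apply Rabs_def2 in Hv; lra]. }
destruct (Req_dec u v) as [->|N].
{ rewrite slope2_diag; assert (K := J v); rewrite Rmin_left, Rmax_left in K by lra.
  specialize (K ltac:(lra)); unfold Rdiv; rewrite <- Rmult_minus_distr_r, Rabs_mult.
  rewrite (Rabs_right (/ 2)) by lra; assert (M := cond_pos eps); lra. }
pose (h x := f x - (x - v) * Derive f v - L / 2 * (x - v) ^ 2).
pose (h' x := Derive f x - Derive f v - L * (x - v)).
assert (Dh : forall x, is_derive h x (h' x)).
{ intros x; unfold h, h'; auto_derive; [exact (D1 x)|]; change (fun y : R => f y) with f; field. }
assert (Dh' : forall x, is_derive h' x (Derive (Derive f) x - L)).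
{ intros x; unfold h'; auto_derive; [exact (D2 x)|]; change (fun y : R => Derive f y) with (Derive f); ring. }
destruct (MVT_gen h v u h') as (c & Hc & E).
{ intros; apply Dh. } { intros; eapply is_derive_continuity_pt, Dh. }
destruct (MVT_gen h' v c (fun x => Derive (Derive f) x - L)) as (e & He & F).
{ intros; apply Dh'. } { intros; eapply is_derive_continuity_pt, Dh'. }
assert (Z : h' v = 0) by (unfold h'; ring).
rewrite Z in F; replace (h' c) with ((Derive (Derive f) e - L) * (c - v)) in E by lra.
assert (B : Rabs (Derive (Derive f) e - L) < eps).
{ apply J; revert Hc He; unfold Rmin, Rmax; repeat destruct Rle_dec; lra. }
assert (C : Rabs (c - v) <= Rabs (u - v)).
{ revert Hc; unfold Rmin, Rmax, Rabs; repeat destruct Rle_dec; repeat destruct Rcase_abs; lra. }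
assert (S : (slope2 f u v - L / 2) * (u - v) ^ 2 = h u - h v).
{ assert (E1 := slope2_spec f u v); assert (E2 := slope_spec f u v); unfold h.
  replace (slope f u v) with (Derive f v - (v - u) * slope2 f u v) in E2 by lra.
  replace (f u) with (f v - (v - u) * (Derive f v - (v - u) * slope2 f u v)) by lra.
  ring. }
assert (P : 0 < Rabs (u - v)) by (apply Rabs_pos_lt; lra).
rewrite E in S; apply (f_equal Rabs) in S; rewrite !Rabs_mult, <- RPow_abs in S.
apply (Rmult_lt_reg_r (Rabs (u - v) ^ 2)); [now apply pow_lt|].
rewrite S; assert (Q := Rabs_pos (c - v)); assert (Q' := Rabs_pos (Derive (Derive f) e - L)).
apply Rle_lt_trans with (Rabs (Derive (Derive f) e - L) * Rabs (u - v) ^ 2).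
- simpl; rewrite Rmult_1_r, <- Rmult_assoc; apply Rmult_le_compat_r; [lra|].
  now apply Rmult_le_compat_l.
- apply Rmult_lt_compat_r; [now apply pow_lt|exact B].
Qed.

Definition pslope (g : R -> point) (s t : R) : point :=
  Point (slope (fun u => px (g u)) s t) (slope (fun u => py (g u)) s t)
        (slope (fun u => pz (g u)) s t).

Definition pslope2 (g : R -> point) (s t : R) : point :=
  Point (slope2 (fun u => px (g u)) s t) (slope2 (fun u => py (g u)) s t)
        (slope2 (fun u => pz (g u)) s t).

Lemma pslope_continuous_diag g t : smooth g -> pcontinuous_2d (pslope g) t t.
Proof.
intros H.
assert (S := smooth_continuous _ t (smooth_velocity _ H)); destruct S as (S1 & S2 & S3).
split; [|split]; simpl; apply slope_continuous_diag; trivial;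
exists (mkposreal 1 Rlt_0_1); intros u _; apply (H 1%nat u).
Qed.

Lemma pslope2_continuous_diag g t : smooth g -> pcontinuous_2d (pslope2 g) t t.
Proof. intros H; split; [|split]; simpl; apply slope2_continuous_diag; intros; apply H. Qed.

Lemma pslope_diag g t : pslope g t t = velocity g t.
Proof. unfold pslope; now rewrite !slope_diag. Qed.

Definition pscal (a : R) (p : point) : point := Point (a * px p) (a * py p) (a * pz p).
Definition padd (p q : point) : point := Point (px p + px q) (py p + py q) (pz p + pz q).

Lemma pslope_spec g s t : psub (g t) (g s) = pscal (t - s) (pslope g s t).
Proof. unfold psub, pscal, pslope; simpl; now rewrite <- !slope_spec. Qed.

Lemma pslope2_spec g s t : velocity g t = padd (pslope g s t) (pscal (t - s) (pslope2 g s t)).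
Proof. unfold padd, pscal, velocity; simpl; now rewrite <- !slope2_spec. Qed.

Lemma pslope2_diag g t : pslope2 g t t = pscal (/ 2) (velocity (velocity g) t).
Proof. unfold pslope2, pscal; rewrite !slope2_diag; f_equal; apply Rmult_comm. Qed.

(* The value at [c t = P] is the limit of the quotient at such a parameter. *)
Definition kern (S : surface) (P : point) (c : R -> point) (t : R) : R :=
  let r := psub (c t) P in
  if Req_EM_T (dot r r) 0 then
    det3 (normal S P) (velocity c t) (velocity (velocity c) t)
    / (2 * dot (velocity c t) (velocity c t))
  else det3 (normal S P) r (velocity c t) / dot r r.

Lemma kern_off S P c t : c t <> P ->
  kern S P c t = det3 (normal S P) (psub (c t) P) (velocity c t)
                 / dot (psub (c t) P) (psub (c t) P).
Proof.
intros H; unfold kern; apply dot_psub_neq in H; now destruct Req_EM_T.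
Qed.

(** With [e = pslope c s t] and [e2 = pslope2 c s t], one has [c t - c s = (t - s) e] and
    [c' t = e + (t - s) e2]. Since [det3 n e e = 0], a factor [(t - s)^2] cancels from the quotient,
    and what is left makes sense on the diagonal. There [e2 = c'' / 2], which accounts for the
    factor 2 in [kern]. *)
Lemma kern_slope S c s t : dot (pslope c s t) (pslope c s t) <> 0 ->
  kern S (c s) c t = det3 (normal S (c s)) (pslope c s t) (pslope2 c s t)
                     / dot (pslope c s t) (pslope c s t).
Proof.
intros H; destruct (Req_dec s t) as [<-|N].
- unfold kern; rewrite pslope_diag in *.
  destruct (Req_EM_T _ _) as [E|E]; [|destruct E; unfold dot, psub; simpl; ring].
  rewrite pslope2_diag; revert H; unfold det3, dot; simpl; intros H; field; exact H.
- rewrite kern_off.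
  + rewrite pslope_spec, (pslope2_spec c s t).
    revert H; generalize (pslope c s t) (pslope2 c s t) (normal S (c s)).
    intros e e2 n H; unfold dot, det3 in *; simpl; field; split; [exact H|].
    replace (_ + _) with ((t - s) * (t - s) * (px e * px e + py e * py e + pz e * pz e))
      by ring.
    repeat apply Rmult_integral_contrapositive_currified; lra.
  + intros E; apply H.
    assert (Q := pslope_spec c s t); rewrite E in Q.
    injection Q as Q1 Q2 Q3; unfold dot.
    assert (A : forall x y, y - y = (t - s) * x -> x = 0).
    { intros x y Hx; apply (Rmult_eq_reg_l (t - s)); lra. }
    simpl; rewrite (A _ _ Q1), (A _ _ Q2), (A _ _ Q3); ring.
Qed.

Lemma pcontinuous_2d_normal S g s t : pcontinuous_2d g s t ->
  pcontinuous_2d (fun u v => normal S (g u v)) s t.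
Proof.
destruct S; [|easy]; intros _.
exact (conj (continuity_2d_pt_const s t 0)
  (conj (continuity_2d_pt_const s t 0) (continuity_2d_pt_const s t 1))).
Qed.

Lemma kern_continuous_off S g c s t : smooth c -> pcontinuous g s -> c t <> g s ->
  continuity_2d_pt (fun u v => kern S (g u) c v) s t.
Proof.
intros Hc Hg N; assert (Hn := dot_psub_neq _ _ N).
assert (Cg := pcontinuous_2d_l g s t Hg).
assert (Cr := pcontinuous_2d_psub _ _ _ _
  (pcontinuous_2d_r c s t (smooth_continuous _ _ Hc)) Cg).
assert (Cd := continuity_2d_dot _ _ _ _ Cr Cr).
apply continuity_2d_pt_ext_loc with
  (fun u v => det3 (normal S (g u)) (psub (c v) (g u)) (velocity c v)
              / dot (psub (c v) (g u)) (psub (c v) (g u))).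
- destruct (continuity_2d_pt_neq_0 _ _ _ Cd Hn) as [d Hd].
  exists d; intros u v Hu Hv; unfold kern; specialize (Hd u v Hu Hv).
  now destruct Req_EM_T.
- apply continuity_2d_div; trivial.
  apply continuity_2d_det3; trivial.
  + now apply pcontinuous_2d_normal.
  + apply pcontinuous_2d_r, smooth_continuous, smooth_velocity, Hc.
Qed.

Lemma kern_continuous_diag S c t : smooth c -> velocity c t <> Point 0 0 0 ->
  continuity_2d_pt (fun u v => kern S (c u) c v) t t.
Proof.
intros Hc N.
assert (Ce := pslope_continuous_diag c t Hc).
assert (Cd := continuity_2d_dot _ _ _ _ Ce Ce).
assert (Hn : dot (pslope c t t) (pslope c t t) <> 0).
{ rewrite pslope_diag; now apply Rgt_not_eq, dot_pos. }
apply continuity_2d_pt_ext_loc with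
  (fun s t => det3 (normal S (c s)) (pslope c s t) (pslope2 c s t)
                     / dot (pslope c s t) (pslope c s t)).
- destruct (continuity_2d_pt_neq_0 _ _ _ Cd Hn) as [d Hd].
  exists d; intros u v Hu Hv; symmetry; apply kern_slope, Hd; trivial.
- apply continuity_2d_div; trivial.
  apply continuity_2d_det3; trivial.
  + apply pcontinuous_2d_normal, pcontinuous_2d_l, smooth_continuous, Hc.
  + apply pslope2_continuous_diag, Hc.
Qed.

Definition immersed (c : R -> point) : Prop := forall t, velocity c t <> Point 0 0 0.

Lemma kern_continuous S P c t : smooth c -> immersed c -> continuity_pt (kern S P c) t.
Proof.
intros Hc Hv.
destruct (Req_EM_T (dot (psub (c t) P) (psub (c t) P)) 0) as [E|E].
- assert (EP : P = c t).
  { apply NNPP; intros N; apply (dot_psub_neq (c t) P); [|exact E].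
    intros F; now apply N. }
  rewrite EP; apply (continuity_2d_section_r (fun u v => kern S (c u) c v)).
  now apply kern_continuous_diag.
- apply (continuity_2d_section_r (fun u v => kern S ((fun _ => P) u) c v) 0).
  apply kern_continuous_off; trivial.
  + split; [|split]; apply continuity_pt_const; easy.
  + intros <-; apply E; unfold dot, psub; simpl; ring.
Qed.

(** * Integrals with a parameter and integrals over a period *)

Lemma continuous_ex_RInt (f : R -> R) a b : (forall t, continuity_pt f t) -> ex_RInt f a b.
Proof.
intros H; apply (ex_RInt_continuous (V := R_CompleteNormedModule)).
intros z _; apply continuity_pt_filterlim, H.
Qed.

Lemma RInt_param_continuous (f : R -> R -> R) a b s : a <= b ->
  (forall t, a <= t <= b -> continuity_2d_pt f s t) -> (forall u, ex_RInt (f u) a b) ->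
  filterlim (fun u => RInt (f u) a b) (locally s) (locally (RInt (f s) a b)).
Proof.
intros Hab Hf Hi; apply filterlim_locally; intros eps.
(* The [+ 1] covers [a = b] and makes the final estimate strict. *)
assert (Hb : 0 < eps / (b - a + 1)) by (apply Rdiv_lt_0_compat; [apply cond_pos|lra]).
destruct (uniform_continuity_2d_1d' f a b s Hf (mkposreal _ Hb)) as [d Hd].
exists d; intros u Hu; change (Rabs (u - s) < d) in Hu.
change (Rabs (RInt (f u) a b - RInt (f s) a b) < eps).
rewrite <- (RInt_minus (V := R_CompleteNormedModule)) by trivial.
apply Rle_lt_trans with ((b - a) * (eps / (b - a + 1))).
- apply abs_RInt_le_const; [exact Hab|now apply (ex_RInt_minus (V := R_NormedModule))|].
  intros t Ht; apply Rlt_le; apply Rabs_def2 in Hu; apply (Hd t s t u); try (assert (K := cond_pos d); lra).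
  rewrite Rminus_diag, Rabs_R0; apply cond_pos.
- set (e := eps / (b - a + 1)) in *.
  replace (pos eps) with ((b - a) * e + e) by (unfold e; field; lra); lra.
Qed.

Lemma RInt_shift (f : R -> R) a b s : (forall t, continuity_pt f t) ->
  RInt (fun t => f (s + t)) a b = RInt f (s + a) (s + b).
Proof.
intros Hf; generalize (RInt_comp_lin (V := R_CompleteNormedModule) f 1 s a b).
rewrite !Rmult_1_l, !(Rplus_comm _ s); intros <-.
- apply RInt_ext; intros x _; change (f (s + x) = 1 * f (1 * x + s)).
  now rewrite !Rmult_1_l, Rplus_comm.
- now apply continuous_ex_RInt.
Qed.

Lemma continuous_RInt_Chasles (f : R -> R) a b c : (forall t, continuity_pt f t) ->
  RInt f a b + RInt f b c = RInt f a c.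
Proof.
intros Hf; apply (RInt_Chasles (V := R_CompleteNormedModule)); now apply continuous_ex_RInt.
Qed.

Lemma RInt_periodic (f : R -> R) a : (forall t, continuity_pt f t) ->
  (forall t, f (t + 1) = f t) -> RInt f a (a + 1) = RInt f 0 1.
Proof.
intros Hf Hp.
rewrite <- (continuous_RInt_Chasles f a 0 (a + 1)), <- (continuous_RInt_Chasles f 0 1 (a + 1))
  by trivial.
assert (E : RInt f a 0 + RInt f 0 a = 0).
{ rewrite continuous_RInt_Chasles by trivial; apply (RInt_point (V := R_CompleteNormedModule)). }
replace (RInt f 1 (a + 1)) with (RInt f 0 a).
- lra.
- replace (a + 1) with (1 + a) by ring; replace 1 with (1 + 0) at 1 by ring.
  rewrite <- RInt_shift by trivial; apply RInt_ext; intros; now rewrite Rplus_comm, Hp.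
Qed.

Definition periodic (c : R -> point) : Prop := forall t, c (t + 1) = c t.

Lemma velocity_periodic c : periodic c -> periodic (velocity c).
Proof.
intros Hc t; unfold velocity.
assert (A : forall f : R -> R, (forall u, f (u + 1) = f u) -> Derive f (t + 1) = Derive f t).
{ intros f Hf; unfold Derive; f_equal; f_equal.
  apply functional_extensionality; intros h.
  now replace (t + 1 + h) with (t + h + 1) by ring; rewrite !Hf. }
f_equal; apply A; intros u; now rewrite Hc.
Qed.

Lemma kern_periodic S P c t : periodic c -> kern S P c (t + 1) = kern S P c t.
Proof.
intros Hc; assert (H := velocity_periodic c Hc); assert (K := velocity_periodic _ H).
unfold kern; now rewrite Hc, H, K.
Qed.

(** * Closedness of the kernel in the two points *)

Definition dnormal (S : surface) (v : point) : point :=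
  match S with Plane => Point 0 0 0 | Sphere => v end.

Lemma is_pderive_normal S g t v : is_pderive g t v ->
  is_pderive (fun u => normal S (g u)) t (dnormal S v).
Proof.
destruct S; [|easy]; intros _.
assert (A : forall k : R, is_derive (fun _ : R => k) t 0).
{ intros k; exact (is_derive_const (V := R_NormedModule) k t). }
exact (conj (A 0) (conj (A 0) (A 1))).
Qed.

Lemma velocity_tangent S c t : smooth c -> (forall u, on_surface S (c u)) ->
  dot (velocity c t) (normal S (c t)) = 0.
Proof.
intros Hc Hs; destruct (smooth_pderive c t Hc) as (D1 & D2 & D3).
assert (U : forall (f : R -> R) k l, is_derive f t l -> (forall u, f u = k) -> l = 0).
{ intros f k l Hf E; apply is_derive_unique in Hf; rewrite <- Hf.
  rewrite (Derive_ext f (fun _ => k)) by exact E; apply Derive_const. }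
destruct S; simpl in Hs.
- unfold dot; simpl; assert (Z := U _ _ _ D3 Hs); simpl in Z; rewrite Z; ring.
- assert (H := is_derive_dot _ _ _ _ _ (smooth_pderive c t Hc) (smooth_pderive c t Hc)).
  apply (U _ 1) in H; [change (normal Sphere (c t)) with (c t); unfold dot in *; lra|].
  intros u; specialize (Hs u); unfold dot; lra.
Qed.

(** Cramer's linear relation among four vectors of [R^3], paired with [e]. On the sphere it is
    applied to [P], [x] and their velocities, with [e = x] and with [e = P], to express the products
    of determinants and dot products in [kernel_closed] by determinants alone. *)
Lemma det3_dot_relation a b c d e :
  det3 b c d * dot a e - det3 a c d * dot b e + det3 a b d * dot c e - det3 a b c * dot d e = 0.
Proof. unfold det3, dot; ring. Qed.

(* Equality of the mixed derivatives: for [K(P,x) = det3 N_P (x-P) dx / |x-P|^2]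
   the form [K(P,x) dt + K(x,P) ds] is closed. *)
Lemma kernel_closed S P x v u : on_surface S P -> on_surface S x ->
  dot v (normal S P) = 0 -> dot u (normal S x) = 0 ->
  let r := psub x P in
  dot r r * (det3 (dnormal S v) r u - det3 (normal S P) v u
             + det3 (dnormal S u) r v + det3 (normal S x) u v)
  + 2 * (det3 (normal S P) r u * dot r v - det3 (normal S x) r v * dot r u) = 0.
Proof.
intros HP Hx Hv Hu r; destruct S; simpl in *.
- unfold r; destruct P as [P1 P2 P3], x as [x1 x2 x3], v as [v1 v2 v3], u as [u1 u2 u3].
  unfold dot, det3, psub in *; simpl in *; subst P3 x3.
  replace v3 with 0 by lra; replace u3 with 0 by lra; ring.
- assert (A := det3_dot_relation P x u v x); assert (B := det3_dot_relation P x u v P).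
  assert (PP : dot P P = 1) by (unfold dot; lra).
  assert (XX : dot x x = 1) by (unfold dot; lra).
  assert (C : forall a b, dot a b = dot b a) by (intros; unfold dot; ring).
  rewrite Hv, PP, (C x P) in B; rewrite Hu, XX in A.
  replace (dot r r) with (2 - 2 * dot P x)
    by (revert PP XX; unfold r, dot, psub; simpl; intros; lra).
  replace (dot r v) with (dot v x - dot v P) by (unfold r, dot, psub; simpl; ring).
  replace (dot r u) with (dot u x - dot u P) by (unfold r, dot, psub; simpl; ring).
  rewrite Hu, Hv.
  replace (det3 v r u - det3 P v u + det3 u r v + det3 x u v)
    with (det3 P u v + det3 x u v) by (unfold r, det3, psub; simpl; ring).
  replace (det3 P r u) with (det3 P x u) by (unfold r, det3, psub; simpl; ring).
  replace (det3 x r v) with (det3 P x v) by (unfold r, det3, psub; simpl; ring).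
  nra.
Qed.

(** * Constancy along semiarcs *)

(* Derivative in [s] of [kern S (g s) c (s + t)]. *)
Definition dkern (S : surface) (g c : R -> point) (s t : R) : R :=
  let r := psub (c (s + t)) (g s) in
  let v := velocity g s in
  let u := velocity c (s + t) in
  let w := velocity (velocity c) (s + t) in
  ((det3 (dnormal S v) r u + det3 (normal S (g s)) (psub u v) u + det3 (normal S (g s)) r w)
     * dot r r - det3 (normal S (g s)) r u * (2 * dot r (psub u v))) / dot r r ^ 2.

Section Translation.
Context (S : surface) (g c : R -> point) (Hg : smooth g) (Hc : smooth c).

Lemma difference_continuous s t : pcontinuous_2d (fun s t => psub (c (s + t)) (g s)) s t.
Proof.
apply pcontinuous_2d_psub.
- apply (pcontinuous_2d_comp c (fun u v => u + v)); [now apply smooth_continuous|].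
  apply continuity_2d_pt_plus; [apply continuity_2d_pt_id1|apply continuity_2d_pt_id2].
- now apply pcontinuous_2d_l, smooth_continuous.
Qed.

Lemma off_locally s t : c (s + t) <> g s -> locally_2d (fun u v => c (u + v) <> g u) s t.
Proof.
intros H; assert (K := difference_continuous s t).
destruct (continuity_2d_pt_neq_0 _ _ _ (continuity_2d_dot _ _ _ _ K K)
  (dot_psub_neq _ _ H)) as [d Hd].
exists d; intros u v Hu Hv E; apply (Hd u v Hu Hv); rewrite E; unfold dot, psub; simpl; ring.
Qed.

Lemma is_derive_kern_base s t : c (s + t) <> g s ->
  is_derive (fun u => kern S (g u) c (u + t)) s (dkern S g c s t).
Proof.
intros H.
apply (is_derive_ext_loc (fun u => det3 (normal S (g u)) (psub (c (u + t)) (g u))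
   (velocity c (u + t)) / dot (psub (c (u + t)) (g u)) (psub (c (u + t)) (g u)))).
{ generalize (locally_2d_1d_const_y _ _ _ (off_locally s t H)).
  apply filter_imp; intros u Hu; symmetry; now apply kern_off. }
assert (G := smooth_pderive g s Hg).
assert (C := proj1 (is_pderive_comp_plus _ _ _ _ (smooth_pderive c (s + t) Hc))).
assert (V := proj1 (is_pderive_comp_plus _ _ _ _
  (smooth_pderive _ (s + t) (smooth_velocity _ Hc)))).
assert (P := is_pderive_psub _ _ _ _ _ C G).
evar_last.
- apply is_derive_div; [apply is_derive_det3|apply is_derive_dot|now apply dot_psub_neq];
    try eassumption.
  apply is_pderive_normal; eassumption.
- simpl; unfold dkern; f_equal; unfold dot, det3; simpl; ring.
Qed.

(** With the argument [s + t], differentiating in [s] moves both the base point [P] and the point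
    [x] on [c]. Motion of [x] gives the [t]-derivative of the first summand; by [kernel_closed],
    motion of [P] gives the [t]-derivative of the second, where the two points are exchanged. So
    [dkern] has an explicit primitive in [t]. *)
Lemma is_derive_kern_sum s t : c (s + t) <> g s ->
  (forall u, on_surface S (g u)) -> (forall u, on_surface S (c u)) ->
  is_derive (fun v => kern S (g s) c (s + v) + kern S (c (s + v)) g s) t (dkern S g c s t).
Proof.
intros H Sg Sc.
apply (is_derive_ext_loc (fun v =>
   det3 (normal S (g s)) (psub (c (s + v)) (g s)) (velocity c (s + v))
     / dot (psub (c (s + v)) (g s)) (psub (c (s + v)) (g s))
   + det3 (normal S (c (s + v))) (psub (g s) (c (s + v))) (velocity g s)
     / dot (psub (c (s + v)) (g s)) (psub (c (s + v)) (g s)))).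
{ generalize (locally_2d_1d_const_x _ _ _ (off_locally s t H)).
  apply filter_imp; intros v Hv; symmetry; rewrite !kern_off by auto.
  f_equal; f_equal; unfold dot, psub; simpl; ring. }
assert (K0 : forall p, is_pderive (fun _ => p) t (Point 0 0 0)).
{ intros p; split; [|split]; exact (is_derive_const (V := R_NormedModule) _ _). }
assert (C := proj2 (is_pderive_comp_plus _ _ _ _ (smooth_pderive c (s + t) Hc))).
assert (V := proj2 (is_pderive_comp_plus _ _ _ _
  (smooth_pderive _ (s + t) (smooth_velocity _ Hc)))).
assert (P := is_pderive_psub _ _ _ _ _ C (K0 (g s))).
assert (Q := is_pderive_psub _ _ _ _ _ (K0 (g s)) C).
assert (N := dot_psub_neq _ _ H).
evar_last.
- apply is_derive_plus_R; apply is_derive_div; try exact N.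
  + exact (is_derive_det3 _ _ _ _ _ _ _ (K0 (normal S (g s))) P V).
  + exact (is_derive_dot _ _ _ _ _ P P).
  + exact (is_derive_det3 _ _ _ _ _ _ _ (is_pderive_normal S _ _ _ C) Q (K0 (velocity g s))).
  + exact (is_derive_dot _ _ _ _ _ P P).
- assert (E := kernel_closed S (g s) (c (s + t)) (velocity g s) (velocity c (s + t))
    (Sg _) (Sc _) (velocity_tangent _ _ _ Hg Sg) (velocity_tangent _ _ _ Hc Sc)).
  (* What remains is an algebraic identity in arbitrary vectors: over the common denominator, the
     numerators differ by minus the left side of [E]. *)
  unfold dkern; revert N E; clear.
  generalize (normal S (g s)) (normal S (c (s + t))) (dnormal S (velocity g s))
    (dnormal S (velocity c (s + t))); intros NP Nx nv nu.
  generalize (velocity g s) (velocity c (s + t)) (velocity (velocity c) (s + t)); intros v u w.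
  generalize (g s) (c (s + t)); intros P x N E; cbv zeta in E; revert N E.
  set (r := psub x P); intros N E.
  replace (det3 (Point 0 0 0) r u + det3 NP (psub u (Point 0 0 0)) u + det3 NP r w)
    with (det3 NP r w) by (unfold det3, psub; simpl; ring).
  replace (det3 nu (psub P x) v + det3 Nx (psub (Point 0 0 0) u) v
           + det3 Nx (psub P x) (Point 0 0 0))
    with (- det3 nu r v - det3 Nx u v) by (unfold r, det3, psub; simpl; ring).
  replace (det3 Nx (psub P x) v) with (- det3 Nx r v) by (unfold r, det3, psub; simpl; ring).
  replace (dot (psub u (Point 0 0 0)) r + dot r (psub u (Point 0 0 0)))
    with (2 * dot r u) by (unfold dot, psub; simpl; ring).
  replace (dot r (psub u v)) with (dot r u - dot r v) by (unfold dot, psub; simpl; ring).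
  replace (det3 NP (psub u v) u) with (- det3 NP v u) by (unfold det3, psub; simpl; ring).
  rewrite <- Rdiv_plus_distr; f_equal; apply Rminus_diag_uniq.
  match type of E with ?A = 0 => transitivity (- A); [ring|rewrite E; ring] end.
Qed.

Lemma dkern_continuous s t : c (s + t) <> g s -> continuity_2d_pt (dkern S g c) s t.
Proof.
intros H; assert (K := difference_continuous s t).
assert (T : continuity_2d_pt (fun u v => u + v) s t).
{ apply continuity_2d_pt_plus; [apply continuity_2d_pt_id1|apply continuity_2d_pt_id2]. }
assert (Sv := smooth_velocity _ Hc).
assert (V : pcontinuous_2d (fun s t => velocity g s) s t).
{ apply pcontinuous_2d_l, smooth_continuous, smooth_velocity, Hg. }
assert (U : pcontinuous_2d (fun s t => velocity c (s + t)) s t).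
{ apply (pcontinuous_2d_comp _ (fun u v => u + v)); [now apply smooth_continuous|exact T]. }
assert (W : pcontinuous_2d (fun s t => velocity (velocity c) (s + t)) s t).
{ apply (pcontinuous_2d_comp _ (fun u v => u + v)); [|exact T].
  now apply smooth_continuous, smooth_velocity. }
assert (UV := pcontinuous_2d_psub _ _ _ _ U V).
assert (NP : pcontinuous_2d (fun s t => normal S (g s)) s t).
{ now apply pcontinuous_2d_normal, pcontinuous_2d_l, smooth_continuous. }
assert (NV : pcontinuous_2d (fun s t => dnormal S (velocity g s)) s t).
{ clear - V; destruct S; [|exact V].
  exact (conj (continuity_2d_pt_const s t 0)
    (conj (continuity_2d_pt_const s t 0) (continuity_2d_pt_const s t 0))). }
assert (Q := continuity_2d_dot _ _ _ _ K K).
assert (N := dot_psub_neq _ _ H).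
unfold dkern; cbv zeta; apply continuity_2d_div.
- apply continuity_2d_pt_minus; apply continuity_2d_pt_mult; trivial.
  + apply continuity_2d_pt_plus; [apply continuity_2d_pt_plus|]; now apply continuity_2d_det3.
  + now apply continuity_2d_det3.
  + apply continuity_2d_pt_mult; [apply continuity_2d_pt_const|now apply continuity_2d_dot].
- simpl; apply continuity_2d_pt_mult; [exact Q|].
  apply continuity_2d_pt_mult; [exact Q|apply continuity_2d_pt_const].
- now apply pow_nonzero.
Qed.

End Translation.

Lemma continuous_bounded (f : R -> R) a b : a <= b -> (forall t, continuity_pt f t) ->
  exists B, 0 < B /\ forall t, a <= t <= b -> Rabs (f t) <= B.
Proof.
intros Hab Hf.
destruct (continuity_ab_maj (fun t => Rabs (f t)) a b Hab) as (x & Hx & _).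
- intros c _; apply (continuity_pt_comp f Rabs); [apply Hf|apply Rcontinuity_abs].
- exists (Rabs (f x) + 1); split; [assert (K := Rabs_pos (f x)); lra|].
  intros t Ht; specialize (Hx t Ht); simpl in Hx; lra.
Qed.

Lemma RInt_small (f : R -> R) a : (forall t, continuity_pt f t) ->
  forall eps, 0 < eps -> exists d, 0 < d /\ forall h, 0 < h < d ->
  Rabs (RInt f (a - h) (a + h)) < eps.
Proof.
intros Hf eps He; destruct (continuous_bounded f (a - 1) (a + 1)) as (B & HB & HfB); [lra|easy|].
assert (P : 0 < eps / (2 * B)) by (apply Rdiv_lt_0_compat; lra).
exists (Rmin 1 (eps / (2 * B))); split; [apply Rmin_glb_lt; lra|].
intros h Hh; assert (M := Rmin_l 1 (eps / (2 * B))); assert (N := Rmin_r 1 (eps / (2 * B))).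
apply Rle_lt_trans with ((a + h - (a - h)) * B).
- apply abs_RInt_le_const; [lra|now apply continuous_ex_RInt|intros; apply HfB; lra].
- apply Rlt_le_trans with (2 * (eps / (2 * B)) * B); [apply Rmult_lt_compat_r; lra|].
  right; field; lra.
Qed.

(** By periodicity the two removed ends fit together to the short interval from [- a] to [a]. *)
Lemma RInt_trim (f : R -> R) : (forall t, continuity_pt f t) -> (forall t, f (t + 1) = f t) ->
  forall eps, 0 < eps -> exists d, 0 < d /\ forall a, 0 < a < d ->
  Rabs (RInt f 0 1 - RInt f a (1 - a)) < eps.
Proof.
intros Hf Hp eps He; destruct (RInt_small f 0 Hf eps He) as (d & Hd & K).
exists d; split; [exact Hd|]; intros a Ha.
replace (RInt f 0 1 - RInt f a (1 - a)) with (RInt f (0 - a) (0 + a)); [now apply K|].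
rewrite <- (RInt_periodic f (0 - a)) by trivial.
rewrite <- (continuous_RInt_Chasles f (0 - a) (0 + a) (0 - a + 1)) by trivial.
replace (0 - a + 1) with (1 - a) by ring; replace (0 + a) with a by ring; lra.
Qed.

Definition circ (S : surface) (P : point) (c : R -> point) : R := RInt (kern S P c) 0 1.

Section Constancy.
Context (S : surface) (g c : R -> point) (s1 s2 : R) (H12 : s1 < s2).
Context (Hg : smooth g) (Hc : smooth c) (Sg : forall t, on_surface S (g t))
  (Sc : forall t, on_surface S (c t)) (Ic : immersed c) (Pc : periodic c).
Context (H1 : forall s t, s1 <= s <= s2 -> continuity_2d_pt (fun u v => kern S (g u) c v) s t).
Context (H2 : forall s t, s1 <= s <= s2 -> continuity_2d_pt (fun u v => kern S (c v) g u) s t).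
Context (H3 : forall s t, s1 <= s <= s2 -> 0 < t < 1 -> c (s + t) <> g s).

(** The offset [t] from [s] places the diagonal of the case [g = c] at [t = 0] modulo 1 for every
    [s], so the fixed interval from [a] to [1 - a] avoids it. This lets one argument serve both for
    a component seen from itself and for two different components. [M] is the primitive of [dkern]
    found in [is_derive_kern_sum]. *)
Let K s t := kern S (g s) c (s + t).
Let M s t := kern S (g s) c (s + t) + kern S (c (s + t)) g s.

Let K_continuous s t : s1 <= s <= s2 -> continuity_2d_pt K s t.
Proof.
intros Hs; apply (continuity_2d_comp (fun u v => kern S (g u) c v) (fun u v => u) (fun u v => u + v)).
- now apply H1.
- apply continuity_2d_pt_id1.
- apply continuity_2d_pt_plus; [apply continuity_2d_pt_id1|apply continuity_2d_pt_id2].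
Qed.

Let M_continuous s t : s1 <= s <= s2 -> continuity_2d_pt M s t.
Proof.
intros Hs; apply continuity_2d_pt_plus; [now apply K_continuous|].
apply (continuity_2d_comp (fun u v => kern S (c v) g u) (fun u v => u) (fun u v => u + v)).
- now apply H2.
- apply continuity_2d_pt_id1.
- apply continuity_2d_pt_plus; [apply continuity_2d_pt_id1|apply continuity_2d_pt_id2].
Qed.

Let K_section s t : continuity_pt (K s) t.
Proof.
apply (continuity_pt_comp (fun t => s + t) (kern S (g s) c)).
- apply continuity_pt_plus; [now apply continuity_pt_const|apply continuity_pt_id].
- now apply kern_continuous.
Qed.

(** Differentiation under the integral gives the integral of [dkern], which its primitive [M]
    evaluates. Trimming is essential: near the diagonal the kernel is only known to be
    continuous. *)
Let trimmed_derive a s : 0 < a < 1 / 2 -> s1 < s < s2 ->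
  is_derive (fun s => RInt (K s) a (1 - a)) s (M s (1 - a) - M s a).
Proof.
intros Ha Hs.
assert (L : locally s (fun u => s1 < u < s2)).
{ apply (open_and (fun u => s1 < u) (fun u => u < s2)); [apply open_gt|apply open_lt|exact Hs]. }
assert (DK : forall u t, s1 < u < s2 -> 0 < t < 1 -> is_derive (fun z => K z t) u (dkern S g c u t)).
{ intros u t Hu Ht; apply is_derive_kern_base; trivial; apply H3; lra. }
assert (R1 : RInt (fun t => Derive (fun u => K u t) s) a (1 - a) = M s (1 - a) - M s a).
{ transitivity (RInt (dkern S g c s) a (1 - a)).
  - apply RInt_ext; rewrite Rmin_left, Rmax_right by lra; intros t Ht.
    apply is_derive_unique, DK; lra.
  - apply is_RInt_unique; apply (is_RInt_derive (V := R_CompleteNormedModule) (M s) (dkern S g c s));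
    rewrite Rmin_left, Rmax_right by lra; intros t Ht.
    + apply is_derive_kern_sum; trivial; apply H3; lra.
    + apply continuity_pt_filterlim, continuity_2d_section_r, dkern_continuous; trivial.
      apply H3; lra. }
rewrite <- R1; apply (is_derive_RInt_param K); rewrite ?Rmin_left, ?Rmax_right by lra.
- revert L; apply filter_imp; intros u Hu t Ht; eexists; apply DK; lra.
- intros t Ht; apply continuity_2d_pt_ext_loc with (dkern S g c).
  + destruct L as [d Hd].
    assert (P : 0 < Rmin d a) by (apply Rmin_glb_lt; [apply cond_pos|lra]).
    exists (mkposreal _ P); simpl; intros u v Hu Hv; symmetry.
    assert (A := Rmin_l d a); assert (B := Rmin_r d a).
    apply is_derive_unique, DK; [apply Hd; change (Rabs (u - s) < d); lra|].
    apply Rabs_def2 in Hv; lra.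
  + apply dkern_continuous; trivial; apply H3; lra.
- apply filter_forall; intros u; apply continuous_ex_RInt, K_section.
Qed.

Lemma circ_constant : circ S (g s1) c = circ S (g s2) c.
Proof.
apply cond_eq; intros eps He.
(* Each trimming costs [eps / 4]. The boundary term is compared twice with [M x 0] and multiplied by
   [s2 - s1], which costs [eps / 2]. *)
assert (He' : 0 < eps / (4 * (s2 - s1))) by (apply Rdiv_lt_0_compat; lra).
destruct (uniform_continuity_2d M s1 s2 (-1) 1 (fun s t Hs _ => M_continuous s t Hs)
  (mkposreal _ He')) as [d Hd]; simpl in Hd.
assert (T : forall s, exists d, 0 < d /\ forall a, 0 < a < d ->
  Rabs (circ S (g s) c - RInt (K s) a (1 - a)) < eps / 4).
{ intros s; destruct (RInt_trim (K s) (K_section s)) with (eps := eps / 4) as (e & Pe & E).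
  - intros t; unfold K; rewrite <- Rplus_assoc; now apply kern_periodic.
  - lra.
  - exists e; split; [exact Pe|]; intros a Ha; specialize (E a Ha).
    unfold K in E at 1; rewrite RInt_shift, Rplus_0_r, RInt_periodic in E; trivial.
    + now intros; apply kern_continuous.
    + now intros; apply kern_periodic.
    + now intros; apply kern_continuous. }
destruct (T s1) as (d1 & P1 & T1), (T s2) as (d2 & P2 & T2).
set (a := Rmin (Rmin d1 d2) (Rmin d (1 / 2)) / 2).
assert (A1 := Rmin_l (Rmin d1 d2) (Rmin d (1 / 2))).
assert (A2 := Rmin_r (Rmin d1 d2) (Rmin d (1 / 2))).
assert (A3 := Rmin_l d1 d2); assert (A4 := Rmin_r d1 d2).
assert (A5 := Rmin_l d (1 / 2)); assert (A6 := Rmin_r d (1 / 2)).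
assert (Pa : 0 < Rmin (Rmin d1 d2) (Rmin d (1 / 2))).
{ repeat apply Rmin_glb_lt; trivial; [apply cond_pos|lra]. }
specialize (T1 a ltac:(unfold a; lra)); specialize (T2 a ltac:(unfold a; lra)).
assert (Ha : 0 < a < 1 / 2) by (unfold a; lra).
assert (Had : a < d) by (unfold a; lra).
clearbody a; clear A1 A2 A3 A4 A5 A6 Pa T.
destruct (MVT_gen (fun s => RInt (K s) a (1 - a)) s1 s2 (fun s => M s (1 - a) - M s a))
  as (x & Hx & E).
- rewrite Rmin_left, Rmax_right by lra; intros x Hx; now apply trimmed_derive.
- rewrite Rmin_left, Rmax_right by lra; intros x Hx.
  apply continuity_pt_filterlim, RInt_param_continuous; [lra| |].
  + intros t _; now apply K_continuous.
  + intros u; apply continuous_ex_RInt, K_section.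
- rewrite Rmin_left, Rmax_right in Hx by lra.
  (* Periodicity brings the upper boundary term to [- a], so both boundary terms lie near [M x 0]
     and nearly cancel. *)
  assert (Q : M x (1 - a) = M x (- a)).
  { unfold M; replace (x + (1 - a)) with (x + - a + 1) by ring.
    now rewrite kern_periodic, Pc. }
  assert (Z := cond_pos d).
  assert (U : Rabs (M x (- a) - M x 0) < eps / (4 * (s2 - s1))).
  { apply Hd; try lra; apply Rabs_def1; lra. }
  assert (V : Rabs (M x a - M x 0) < eps / (4 * (s2 - s1))).
  { apply Hd; try lra; apply Rabs_def1; lra. }
  rewrite Q in E; apply Rabs_def2 in U; apply Rabs_def2 in V.
  assert (W : Rabs ((M x (- a) - M x a) * (s2 - s1)) < eps / 2).
  { rewrite Rabs_mult, (Rabs_right (s2 - s1)) by lra.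
    replace (eps / 2) with (2 * (eps / (4 * (s2 - s1))) * (s2 - s1)) by (field; lra).
    apply Rmult_lt_compat_r; [lra|]; apply Rabs_def1; lra. }
  rewrite <- E in W; apply Rabs_def2 in T1; apply Rabs_def2 in T2; apply Rabs_def2 in W.
  apply Rabs_def1; lra.
Qed.

End Constancy.

(** * Jumps at double points *)

Lemma atan_near_right e : 0 < e -> exists X, 0 < X /\ forall x, X < x -> PI / 2 - e < atan x.
Proof.
intros He; assert (P := PI_RGT_0).
(* The cap [PI / 4] keeps [PI / 2 - e'] strictly between 0 and [PI / 2], where [tan] is positive and
   [atan] inverts it. *)
set (e' := Rmin e (PI / 4)).
assert (A := Rmin_l e (PI / 4)); assert (B := Rmin_r e (PI / 4)).
assert (C : 0 < e') by (apply Rmin_glb_lt; lra); fold e' in A, B.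
exists (tan (PI / 2 - e')); split; [apply tan_gt_0; lra|].
intros x Hx; apply atan_increasing in Hx; rewrite atan_tan in Hx by lra; lra.
Qed.

Section Quadratic.
Context (A B E d : R) (HA : 0 < A) (HB : 0 < B) (Hd : d <> 0) (Hdet : A * B - E ^ 2 = d ^ 2).

(** The squared length of [t e - h a] for vectors with [|e|^2 = B], [e.a = E] and [|a|^2 = A]; then
    [|d|] is the area of the parallelogram they span. This models [|c t - g s|^2] near a transverse
    crossing. *)
Definition quad (h t : R) : R := B * t ^ 2 - 2 * t * h * E + A * h ^ 2.

(** The smallest eigenvalue of a positive form is at least its determinant divided by its trace.
    Explicitly, the difference multiplied by [A + B] is [(B t - E h)^2 + (E t - A h)^2]. *)
Lemma quad_lower h t : d ^ 2 / (A + B) * (t ^ 2 + h ^ 2) <= quad h t.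
Proof.
apply (Rmult_le_reg_l (A + B)); [lra|].
replace ((A + B) * (d ^ 2 / (A + B) * (t ^ 2 + h ^ 2))) with (d ^ 2 * (t ^ 2 + h ^ 2))
  by (field; lra).
rewrite <- Hdet; unfold quad.
assert (P := pow2_ge_0 (B * t - E * h)); assert (Q := pow2_ge_0 (E * t - A * h)); nra.
Qed.

Lemma quad_pos h t : h <> 0 -> 0 < quad h t.
Proof.
intros Hh; eapply Rlt_le_trans; [|apply quad_lower].
assert (P := pow2_gt_0 d Hd); assert (Q := pow2_gt_0 h Hh); assert (S := pow2_ge_0 t).
apply Rmult_lt_0_compat; [apply Rdiv_lt_0_compat|]; lra.
Qed.

(** Completing the square, [B * quad h t = (B t - h E)^2 + (h d)^2], so the primitive is an
    arctangent. *)
Lemma quad_RInt h t0 D : 0 < h ->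
  is_RInt (fun t => h / quad h (t - t0)) (t0 - D) (t0 + D)
    ((atan ((B * D - h * E) / (h * Rabs d)) + atan ((B * D + h * E) / (h * Rabs d))) / Rabs d).
Proof.
intros Hh; assert (Pd := Rabs_pos_lt d Hd).
assert (Ed : Rabs d ^ 2 = d ^ 2) by apply pow2_abs.
evar_last.
- apply (is_RInt_derive (V := R_CompleteNormedModule)
    (fun t => atan ((B * (t - t0) - h * E) / (h * Rabs d)) / Rabs d)).
  + intros t _; assert (Q := quad_pos h (t - t0) ltac:(lra)).
    auto_derive; [trivial|].
    assert (Z : h * Rabs d <> 0) by nra.
    match goal with |- context [1 + ?X] =>
      replace (1 + X) with (B * quad h (t - t0) / (h * Rabs d) ^ 2) end.
    * field; repeat split; lra.
    * replace (B * quad h (t - t0)) with ((h * Rabs d) ^ 2 + (B * (t - t0) - h * E) ^ 2)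
        by (rewrite Rpow_mult_distr, Ed, <- Hdet; unfold quad; ring).
      field; lra.
  + intros t _; apply continuity_pt_filterlim, continuity_pt_div.
    * now apply continuity_pt_const.
    * unfold quad; apply derivable_continuous_pt; auto_derive; trivial.
    * apply Rgt_not_eq, quad_pos; lra.
- replace (t0 + D - t0) with D by ring.
  replace (B * (t0 - D - t0) - h * E) with (- (B * D + h * E)) by ring.
  rewrite Rdiv_opp_l, atan_opp.
  unfold minus, plus, opp; simpl; field; lra.
Qed.

Lemma quad_RInt_bounds h t0 D : 0 < h -> 0 < D ->
  ex_RInt (fun t => h / quad h (t - t0)) (t0 - D) (t0 + D) /\
  0 <= RInt (fun t => h / quad h (t - t0)) (t0 - D) (t0 + D) <= PI / Rabs d.
Proof.
intros Hh HD; assert (I := quad_RInt h t0 D Hh); assert (Pd := Rabs_pos_lt d Hd).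
split; [eexists; exact I|split].
- apply RInt_ge_0; [lra|eexists; exact I|].
  intros t _; apply Rlt_le, Rdiv_lt_0_compat; [exact Hh|apply quad_pos; lra].
- rewrite (is_RInt_unique _ _ _ _ I); apply Rmult_le_compat_r;
    [now apply Rlt_le, Rinv_0_lt_compat|].
  generalize (atan_bound ((B * D - h * E) / (h * Rabs d)))
    (atan_bound ((B * D + h * E) / (h * Rabs d))); lra.
Qed.

Lemma quad_RInt_limit e t0 D : 0 < e -> 0 < D -> exists n, 0 < n /\ forall h, 0 < h < n ->
  PI / Rabs d - e < RInt (fun t => h / quad h (t - t0)) (t0 - D) (t0 + D).
Proof.
intros He HD; assert (Pd := Rabs_pos_lt d Hd).
destruct (atan_near_right (e * Rabs d / 2)) as (X & PX & HX); [nra|].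
(* Below this bound on [h] both [B * D + h * E] and [B * D - h * E] exceed [X * h * |d|], so each
   arctangent is within [e * |d| / 2] of [PI / 2]. *)
exists (B * D / (Rabs E + X * Rabs d)).
assert (PE := Rabs_pos E); assert (Q : 0 < Rabs E + X * Rabs d) by nra.
split; [apply Rdiv_lt_0_compat; nra|].
intros h [H0 H1].
assert (H2 : h * (Rabs E + X * Rabs d) < B * D).
{ apply (Rmult_lt_compat_r _ _ _ Q) in H1; field_simplify in H1; lra. }
rewrite (is_RInt_unique _ _ _ _ (quad_RInt h t0 D H0)).
assert (F : forall y, Rabs y <= h * Rabs E -> X < (B * D + y) / (h * Rabs d)).
{ intros y Hy; apply (Rmult_lt_reg_r (h * Rabs d)); [nra|].
  replace ((B * D + y) / (h * Rabs d) * (h * Rabs d)) with (B * D + y) by (field; lra).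
  apply Rabs_le_between in Hy; lra. }
assert (F1 := HX _ (F (- (h * E)) ltac:(rewrite Rabs_Ropp, Rabs_mult, (Rabs_right h); lra))).
assert (F2 := HX _ (F (h * E) ltac:(rewrite Rabs_mult, (Rabs_right h); lra))).
apply (Rmult_lt_reg_r (Rabs d)); [lra|].
replace ((PI / Rabs d - e) * Rabs d) with (PI - e * Rabs d) by (field; lra).
unfold Rdiv at 1; rewrite Rmult_assoc, Rinv_l, Rmult_1_r by lra; unfold Rminus at 2; lra.
Qed.

End Quadratic.

(** Near the crossing [K] is [- d h / quad] up to two errors: a bounded one, whose integral is of
    order [De], and a small multiple of [h / quad]. The integral of [h / quad] tends to [PI / |d|]
    as [h] decreases to 0, whatever the window [De]; this leaves a half turn with the sign of
    [- d]. *)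
Lemma near_integral (K T D E11 E12 E22 : R -> R -> R) (s0 t0 : R) :
  continuity_2d_pt T s0 t0 -> continuity_2d_pt D s0 t0 -> continuity_2d_pt E11 s0 t0 ->
  continuity_2d_pt E12 s0 t0 -> continuity_2d_pt E22 s0 t0 ->
  0 < E11 s0 t0 -> 0 < E22 s0 t0 -> D s0 t0 <> 0 ->
  E22 s0 t0 * E11 s0 t0 - E12 s0 t0 ^ 2 = D s0 t0 ^ 2 ->
  (forall s t, continuity_pt (K s) t) ->
  locally_2d (fun s t => s <> s0 ->
    K s t * (E11 s t * (t - t0) ^ 2 - 2 * (t - t0) * (s - s0) * E12 s t
             + E22 s t * (s - s0) ^ 2)
    = (t - t0) ^ 2 * T s t - (s - s0) * D s t) s0 t0 ->
  forall eps, 0 < eps -> exists D0, 0 < D0 /\ forall De, 0 < De < D0 ->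
    exists n, 0 < n /\ forall h, 0 < h < n ->
    Rabs (RInt (K (s0 + h)) (t0 - De) (t0 + De) + D s0 t0 / Rabs (D s0 t0) * PI) < eps.
Proof.
intros CT CD C11 C12 C22 HB HA Hd Hdet CK HK eps Heps.
set (d := D s0 t0) in *; set (B := E11 s0 t0) in *; set (E := E12 s0 t0) in *.
set (A := E22 s0 t0) in *.
assert (Pd := Rabs_pos_lt d Hd); assert (PPI := PI_RGT_0).
set (c := d ^ 2 / (A + B)).
assert (Pc : 0 < c) by (apply Rdiv_lt_0_compat; [now apply pow2_gt_0|lra]).
set (TB := Rabs (T s0 t0) + 1).
assert (PT : 0 < TB) by (unfold TB; generalize (Rabs_pos (T s0 t0)); lra).
(* [1 / 2] ensures [Q >= q / 2] below; the second bound ensures [e1 * (PI / |d|) <= eps / 4]. *)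
set (e2 := Rmin (1 / 2) (eps * Rabs d / (8 * (Rabs d + 1) * PI))).
assert (Q2 := Rmin_l (1 / 2) (eps * Rabs d / (8 * (Rabs d + 1) * PI))).
assert (Q2' := Rmin_r (1 / 2) (eps * Rabs d / (8 * (Rabs d + 1) * PI))).
assert (P2 : 0 < e2).
{ apply Rmin_glb_lt; [lra|apply Rdiv_lt_0_compat; [nra|]].
  apply Rmult_lt_0_compat; lra. }
fold e2 in Q2, Q2'.
(* Tolerance on the coefficients: with [c * (tau^2 + h^2) <= q], it turns the coefficientwise errors
   into [|Q - q| <= e2 * q]. *)
set (e4 := Rmin e2 (e2 * c / 2)).
assert (Q4 := Rmin_l e2 (e2 * c / 2)); assert (Q4' := Rmin_r e2 (e2 * c / 2)).
assert (P4 : 0 < e4) by (apply Rmin_glb_lt; [lra|nra]).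
fold e4 in Q4, Q4'.
set (p4 := mkposreal e4 P4).
destruct (locally_2d_and _ _ _ _ HK (locally_2d_and _ _ _ _ (CT p4) (locally_2d_and _ _ _ _
  (CD p4) (locally_2d_and _ _ _ _ (C11 p4) (locally_2d_and _ _ _ _ (C12 p4) (C22 p4))))))
  as [rho Hrho]; change (pos p4) with e4 in Hrho.
set (B' := 2 * TB / c).
assert (PB' : 0 < B') by (apply Rdiv_lt_0_compat; lra).
set (e1 := 2 * (Rabs d + 1) * e2).
assert (P1 : 0 < e1) by (apply Rmult_lt_0_compat; lra).
assert (pointwise : forall h t, 0 < h < rho -> Rabs (t - t0) < rho ->
  Rabs (K (s0 + h) t + d * (h / quad A B E h (t - t0)))
    <= B' + e1 * (h / quad A B E h (t - t0))).
{ intros h t Hh Ht.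
  destruct (Hrho (s0 + h) t) as (R0 & RT & RD & R11 & R12 & R22); [|exact Ht|].
  { apply Rabs_def1; lra. }
  specialize (R0 ltac:(lra)); replace (s0 + h - s0) with h in R0 by ring.
  set (tau := t - t0) in *; set (q := quad A B E h tau).
  set (Q := E11 (s0 + h) t * tau ^ 2 - 2 * tau * h * E12 (s0 + h) t
            + E22 (s0 + h) t * h ^ 2) in *.
  assert (q0 : 0 < q) by (apply (quad_pos A B E d); trivial; lra).
  assert (ql : c * (tau ^ 2 + h ^ 2) <= q) by now apply quad_lower.
  assert (S := pow2_ge_0 tau); assert (S' : 0 < h ^ 2) by (apply pow2_gt_0; lra).
  assert (QQ : Rabs (Q - q) <= e2 * q).
  { fold B in R11; fold E in R12; fold A in R22.
    replace (Q - q) with ((E11 (s0 + h) t - B) * tau ^ 2 - (E12 (s0 + h) t - E) * (2 * tau * h)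
      + (E22 (s0 + h) t - A) * h ^ 2) by (unfold Q, q, quad; ring).
    apply Rle_trans with (e4 * (2 * (tau ^ 2 + h ^ 2))).
    - assert (X : Rabs (2 * tau * h) <= tau ^ 2 + h ^ 2).
      { apply Rabs_le; assert (Y := pow2_ge_0 (tau + h)); assert (Z := pow2_ge_0 (tau - h)); nra. }
      eapply Rle_trans; [apply Rabs_triang|].
      eapply Rle_trans; [apply Rplus_le_compat_r; unfold Rminus at 1; apply Rabs_triang|].
      rewrite Rabs_Ropp, !Rabs_mult, (Rabs_right (tau ^ 2)), (Rabs_right (h ^ 2)) by lra.
      rewrite !Rabs_mult in X.
      generalize dependent (Rabs (E11 (s0 + h) t - B)).
      generalize dependent (Rabs (E22 (s0 + h) t - A)).
      generalize (Rabs_pos (E12 (s0 + h) t - E)).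
      generalize dependent (Rabs (E12 (s0 + h) t - E)).
      generalize dependent (Rabs 2 * Rabs tau * Rabs h).
      intros m Hm x Hx x0 y Hy z Hz; nra.
    - apply Rle_trans with (e2 * c / 2 * (2 * (tau ^ 2 + h ^ 2))); [nra|].
      replace (e2 * c / 2 * (2 * (tau ^ 2 + h ^ 2))) with (e2 * (c * (tau ^ 2 + h ^ 2))) by field.
      nra. }
  assert (Qh : q / 2 <= Q).
  { apply Rabs_le_between in QQ; nra. }
  assert (KE : K (s0 + h) t = (tau ^ 2 * T (s0 + h) t - h * D (s0 + h) t) / Q).
  { apply (Rmult_eq_reg_r Q); [rewrite R0; field; lra|lra]. }
  (* The first summand is bounded by [B'], because [Q >= q / 2 >= c * tau^2 / 2]. In the second, the
     factor before [h / q] is at most [(|d| + 1) * e2 * q / Q <= e1]. *)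
  replace (K (s0 + h) t + d * (h / q)) with
    (T (s0 + h) t * (tau ^ 2 / Q)
     + (d * (Q - q) - (D (s0 + h) t - d) * q) / Q * (h / q))
    by (rewrite KE; field; lra).
  eapply Rle_trans; [apply Rabs_triang|]; apply Rplus_le_compat.
  - rewrite Rabs_mult.
    assert (TT : Rabs (T (s0 + h) t) <= TB).
    { unfold TB; replace (T (s0 + h) t) with (T s0 t0 + (T (s0 + h) t - T s0 t0)) by ring.
      eapply Rle_trans; [apply Rabs_triang|]; lra. }
    assert (FF : 0 <= tau ^ 2 / Q <= 2 / c).
    { split; [apply Rdiv_le_0_compat; lra|].
      apply (Rmult_le_reg_r (Q * c)); [nra|].
      replace (tau ^ 2 / Q * (Q * c)) with (tau ^ 2 * c) by (field; lra).
      replace (2 / c * (Q * c)) with (2 * Q) by (field; lra); nra. }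
    rewrite (Rabs_right (tau ^ 2 / Q)) by lra; unfold B'.
    replace (2 * TB / c) with (TB * (2 / c)) by (field; lra).
    apply Rmult_le_compat; lra || apply Rabs_pos.
  - rewrite Rabs_mult, (Rabs_right (h / q)) by (apply Rle_ge, Rlt_le, Rdiv_lt_0_compat; lra).
    apply Rmult_le_compat_r; [apply Rlt_le, Rdiv_lt_0_compat; lra|].
    unfold Rdiv; rewrite Rabs_mult, (Rabs_right (/ Q))
      by (apply Rle_ge, Rlt_le, Rinv_0_lt_compat; lra).
    apply (Rmult_le_reg_r Q); [lra|]; rewrite Rmult_assoc, Rinv_l, Rmult_1_r by lra.
    eapply Rle_trans; [unfold Rminus at 1; apply Rabs_triang|].
    rewrite Rabs_Ropp, !Rabs_mult, (Rabs_right q) by lra.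
    assert (RD' : Rabs (D (s0 + h) t - d) <= e2) by (fold d in RD; lra).
    apply Rle_trans with ((Rabs d + 1) * e2 * q).
    2: { replace (e1 * Q) with ((Rabs d + 1) * e2 * (2 * Q)) by (unfold e1; ring).
      apply Rmult_le_compat_l; [apply Rmult_le_pos; lra|lra]. }
    assert (Rabs d * Rabs (Q - q) <= Rabs d * (e2 * q)) by (apply Rmult_le_compat_l; lra).
    assert (Rabs (D (s0 + h) t - d) * q <= e2 * q) by (apply Rmult_le_compat_r; lra).
    lra. }
(* A window of length [2 * De] lets the bounded error contribute at most [eps / 4]; [S1], [S2] and
   [S3] together give [3 * eps / 4]. *)
exists (Rmin rho (eps / (8 * B'))).
assert (M1 := Rmin_l rho (eps / (8 * B'))); assert (M2 := Rmin_r rho (eps / (8 * B'))).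
split; [apply Rmin_glb_lt; [apply cond_pos|apply Rdiv_lt_0_compat; lra]|].
intros De HDe.
destruct (quad_RInt_limit A B E d HA HB Hd Hdet (eps / (4 * Rabs d)) t0 De)
  as (n & Pn & Hn); [apply Rdiv_lt_0_compat; lra|lra|].
exists (Rmin rho n); split; [apply Rmin_glb_lt; [apply cond_pos|exact Pn]|].
intros h Hh; assert (M3 := Rmin_l rho n); assert (M4 := Rmin_r rho n).
specialize (Hn h ltac:(lra)).
destruct (quad_RInt_bounds A B E d HA HB Hd Hdet h t0 De ltac:(lra) ltac:(lra)) as (I0 & I1 & I2).
set (f := fun t => h / quad A B E h (t - t0)) in *; set (I := RInt f (t0 - De) (t0 + De)) in *.
assert (CKh := continuous_ex_RInt (K (s0 + h)) (t0 - De) (t0 + De) (CK (s0 + h))).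
assert (J1 : ex_RInt (fun t => d * f t) (t0 - De) (t0 + De))
  by exact (ex_RInt_scal (V := R_NormedModule) _ _ _ d I0).
assert (J2 : ex_RInt (fun t => e1 * f t) (t0 - De) (t0 + De))
  by exact (ex_RInt_scal (V := R_NormedModule) _ _ _ e1 I0).
assert (J3 : ex_RInt (fun _ => B') (t0 - De) (t0 + De)) by apply ex_RInt_const.
assert (L1 : RInt (fun t => K (s0 + h) t + d * f t) (t0 - De) (t0 + De)
  = RInt (K (s0 + h)) (t0 - De) (t0 + De) + d * I).
{ rewrite (RInt_plus (V := R_CompleteNormedModule)) by assumption.
  now rewrite (RInt_scal (V := R_CompleteNormedModule)). }
assert (L2 : RInt (fun t => B' + e1 * f t) (t0 - De) (t0 + De) = 2 * De * B' + e1 * I).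
{ rewrite (RInt_plus (V := R_CompleteNormedModule)) by assumption.
  rewrite (RInt_scal (V := R_CompleteNormedModule)), (RInt_const (V := R_CompleteNormedModule))
    by assumption.
  change ((t0 + De - (t0 - De)) * B' + e1 * I = 2 * De * B' + e1 * I); ring. }
assert (J4 := ex_RInt_plus (V := R_NormedModule) _ _ _ _ CKh J1).
assert (J5 := ex_RInt_plus (V := R_NormedModule) _ _ _ _ J3 J2).
assert (main : Rabs (RInt (K (s0 + h)) (t0 - De) (t0 + De) + d * I) <= 2 * De * B' + e1 * I).
{ rewrite <- L1, <- L2; eapply Rle_trans; [apply abs_RInt_le; [lra|exact J4]|].
  apply RInt_le; [lra|exact (ex_RInt_norm _ _ _ J4)|exact J5|].
  intros t Ht; apply pointwise; [lra|apply Rabs_def1; lra]. }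
assert (S1 : 2 * De * B' <= eps / 4).
{ apply Rle_trans with (2 * (eps / (8 * B')) * B'); [apply Rmult_le_compat_r; lra|right; field; lra]. }
assert (S2 : e1 * I <= eps / 4).
{ apply Rle_trans with (e1 * (PI / Rabs d)); [apply Rmult_le_compat_l; lra|].
  apply Rle_trans with (2 * (Rabs d + 1) * (eps * Rabs d / (8 * (Rabs d + 1) * PI)) * (PI / Rabs d)).
  - apply Rmult_le_compat_r; [apply Rlt_le, Rdiv_lt_0_compat; lra|].
    apply Rmult_le_compat_l; lra.
  - right; field; lra. }
assert (S3 : Rabs (d / Rabs d * PI - d * I) <= eps / 4).
{ replace (d / Rabs d * PI - d * I) with (d * (PI / Rabs d - I)) by (field; lra).
  rewrite Rabs_mult, (Rabs_right (PI / Rabs d - I)) by lra.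
  apply Rle_trans with (Rabs d * (eps / (4 * Rabs d))); [apply Rmult_le_compat_l; lra|right; field; lra]. }
replace (RInt (K (s0 + h)) (t0 - De) (t0 + De) + d / Rabs d * PI)
  with (RInt (K (s0 + h)) (t0 - De) (t0 + De) + d * I + (d / Rabs d * PI - d * I)) by ring.
eapply Rle_lt_trans; [apply Rabs_triang|]; lra.
Qed.

(** * The kernel near a double point *)

Lemma kern_mult S P c t :
  kern S P c t * dot (psub (c t) P) (psub (c t) P)
  = det3 (normal S P) (psub (c t) P) (velocity c t).
Proof.
destruct (classic (c t = P)) as [E|N].
- rewrite E; unfold dot, det3, psub; simpl; ring.
- rewrite kern_off by exact N; field; now apply dot_psub_neq.
Qed.

(** The square of [det3 n a b] is the Gram determinant of the three vectors, which reduces to that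
    of [a] and [b] when [n] is a unit vector orthogonal to both. *)
Lemma gram_det3 n a b : dot n n = 1 -> dot a n = 0 -> dot b n = 0 ->
  dot a a * dot b b - dot b a ^ 2 = det3 n a b ^ 2.
Proof.
intros N A B.
replace (det3 n a b ^ 2) with
  (dot n n * (dot a a * dot b b - dot b a ^ 2)
   - dot a n * (dot a n * dot b b - dot b a * dot b n)
   + dot b n * (dot a n * dot b a - dot a a * dot b n))
  by (unfold det3, dot; ring).
rewrite N, A, B; ring.
Qed.

Lemma normal_unit S P : on_surface S P -> dot (normal S P) (normal S P) = 1.
Proof. destruct S; simpl; unfold dot; simpl; intros; lra. Qed.

(** [alpha] stands for the difference quotient of [g] at [s0]. Asking only for its continuity lets
    the same argument apply to [g] traversed backwards, which yields the limit from the left. *)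
Section Jump.
Context (S : surface) (g alpha c : R -> point) (s0 t0 : R).
Context (Hg : pcontinuous g s0) (Ha : pcontinuous alpha s0).
Context (Hga : forall s, psub (g s) (g s0) = pscal (s - s0) (alpha s)).
Context (Hc : smooth c) (Ic : immersed c) (Pc : periodic c) (Sc : forall t, on_surface S (c t)).
Context (Hx : g s0 = c t0) (Ta : dot (alpha s0) (normal S (g s0)) = 0).
Context (far : forall t, t0 < t < t0 + 1 -> continuity_2d_pt (fun u v => kern S (g u) c v) s0 t).

Let d := det3 (normal S (g s0)) (alpha s0) (velocity c t0).

(** Write [e], [e2] for the slopes of [c] at [t0]. Then [c t - g s = (t - t0) e - (s - s0) alpha]
    and [c' t = e + (t - t0) e2]. Expanding the determinant and using [det3 n e e = 0] leaves [(t -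
    t0)^2 det3 n e e2 - (s - s0) det3 n alpha c'], the shape required by [near_integral]. *)
Lemma near_crossing : d <> 0 -> forall eps, 0 < eps ->
  exists D0, 0 < D0 /\ forall De, 0 < De < D0 ->
    exists n, 0 < n /\ forall h, 0 < h < n ->
    Rabs (RInt (kern S (g (s0 + h)) c) (t0 - De) (t0 + De) + d / Rabs d * PI) < eps.
Proof.
intros Hd.
assert (Cn : pcontinuous_2d (fun s _ => normal S (g s)) s0 t0)
  by now apply pcontinuous_2d_normal, pcontinuous_2d_l.
assert (Ca : pcontinuous_2d (fun s _ => alpha s) s0 t0) by now apply pcontinuous_2d_l.
assert (Ce : pcontinuous_2d (fun _ t => pslope c t0 t) s0 t0).
{ apply pcontinuous_2d_r; destruct (pslope_continuous_diag c t0 Hc) as (E1 & E2 & E3).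
  split; [|split]; now apply (continuity_2d_section_r _ t0). }
assert (Ce2 : pcontinuous_2d (fun _ t => pslope2 c t0 t) s0 t0).
{ apply pcontinuous_2d_r; destruct (pslope2_continuous_diag c t0 Hc) as (E1 & E2 & E3).
  split; [|split]; now apply (continuity_2d_section_r _ t0). }
assert (Cu : pcontinuous_2d (fun _ t => velocity c t) s0 t0)
  by now apply pcontinuous_2d_r, smooth_continuous, smooth_velocity.
assert (Na : alpha s0 <> Point 0 0 0).
{ intros E; apply Hd; unfold d; rewrite E; unfold det3; simpl; ring. }
unfold d; apply (near_integral (fun s t => kern S (g s) c t)
  (fun s t => det3 (normal S (g s)) (pslope c t0 t) (pslope2 c t0 t))
  (fun s t => det3 (normal S (g s)) (alpha s) (velocity c t))
  (fun s t => dot (pslope c t0 t) (pslope c t0 t))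
  (fun s t => dot (pslope c t0 t) (alpha s))
  (fun s t => dot (alpha s) (alpha s)) s0 t0);
  try (apply continuity_2d_det3 || apply continuity_2d_dot); trivial.
- rewrite pslope_diag; apply dot_pos, Ic.
- now apply dot_pos.
- rewrite pslope_diag; apply gram_det3; trivial.
  + rewrite Hx; apply normal_unit, Sc.
  + rewrite Hx; now apply velocity_tangent.
- intros s t; now apply kern_continuous.
- apply locally_2d_forall; intros s t _.
  assert (K := kern_mult S (g s) c t).
  assert (R : psub (c t) (g s) = psub (pscal (t - t0) (pslope c t0 t)) (pscal (s - s0) (alpha s))).
  { rewrite <- Hga, <- pslope_spec, Hx; unfold psub; simpl; f_equal; ring. }
  rewrite R in K; cbv beta.
  match goal with |- ?A * ?B = _ =>
    replace B with (dot (psub (pscal (t - t0) (pslope c t0 t)) (pscal (s - s0) (alpha s)))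
      (psub (pscal (t - t0) (pslope c t0 t)) (pscal (s - s0) (alpha s))))
      by (unfold dot, psub; simpl; ring) end.
  rewrite K, (pslope2_spec c t0 t); unfold det3, psub; simpl; ring.
Qed.

(** The jump comes from a small window around [t0]. For [s = s0] the kernel is continuous there and
    the window contributes almost nothing; for [s] slightly larger it contributes almost a half
    turn. The rest of the circle depends continuously on [s]. *)
Lemma circ_jump_right : d <> 0 ->
  filterlim (fun s => circ S (g s) c) (at_right s0)
    (locally (circ S (g s0) c - d / Rabs d * PI)).
Proof.
intros Hd; apply filterlim_locally; intros eps.
assert (He : 0 < eps / 3) by (generalize (cond_pos eps); lra).
assert (CK : forall P t, continuity_pt (kern S P c) t) by now intros; apply kern_continuous.
destruct (near_crossing Hd _ He) as (D0 & PD & HD).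
destruct (RInt_small (kern S (g s0) c) t0 (CK (g s0)) _ He) as (D1 & PD1 & HD1).
set (De := Rmin (Rmin D0 D1) (1 / 4) / 2).
assert (A1 := Rmin_l (Rmin D0 D1) (1 / 4)); assert (A2 := Rmin_r (Rmin D0 D1) (1 / 4)).
assert (A3 := Rmin_l D0 D1); assert (A4 := Rmin_r D0 D1).
assert (A5 : 0 < Rmin (Rmin D0 D1) (1 / 4)) by (repeat apply Rmin_glb_lt; lra).
destruct (HD De) as (n & Pn & Hn); [unfold De; lra|].
specialize (HD1 De ltac:(unfold De; lra)).
assert (BD : 0 < De < 1 / 4) by (unfold De; lra); clearbody De.
assert (F := RInt_param_continuous (fun s => kern S (g s) c) (t0 + De) (t0 - De + 1) s0
  ltac:(lra) (fun t Ht => far t ltac:(lra))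
  (fun u => continuous_ex_RInt _ _ _ (CK (g u)))).
destruct (proj1 (filterlim_locally _ _) F (mkposreal _ He)) as [d1 H1].
exists (mkposreal _ (Rmin_pos d1 n (cond_pos d1) Pn)); simpl; intros s Bs Hs.
change (Rabs (s - s0) < Rmin d1 n) in Bs.
assert (A6 := Rmin_l d1 n); assert (A7 := Rmin_r d1 n).
specialize (H1 s); change (Rabs (s - s0) < d1 -> Rabs (RInt (kern S (g s) c) (t0 + De)
  (t0 - De + 1) - RInt (kern S (g s0) c) (t0 + De) (t0 - De + 1)) < eps / 3) in H1.
specialize (H1 ltac:(lra)); apply Rabs_def2 in Bs.
specialize (Hn (s - s0) ltac:(lra)); replace (s0 + (s - s0)) with s in Hn by ring.
assert (Sp : forall P, circ S P c = RInt (kern S P c) (t0 - De) (t0 + De)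
  + RInt (kern S P c) (t0 + De) (t0 - De + 1)).
{ intros P; rewrite continuous_RInt_Chasles by apply CK; symmetry; apply RInt_periodic;
    [apply CK|intros t; now apply kern_periodic]. }
change (Rabs (circ S (g s) c - (circ S (g s0) c - d / Rabs d * PI)) < eps).
rewrite !Sp; apply Rabs_def2 in H1; apply Rabs_def2 in Hn; apply Rabs_def2 in HD1.
apply Rabs_def1; lra.
Qed.

End Jump.

Lemma circ_jump S g c s0 t0 : smooth g -> smooth c -> immersed c -> periodic c ->
  (forall s, on_surface S (g s)) -> (forall t, on_surface S (c t)) -> g s0 = c t0 ->
  (forall t, t0 < t < t0 + 1 -> continuity_2d_pt (fun u v => kern S (g u) c v) s0 t) ->
  let d := det3 (normal S (g s0)) (velocity g s0) (velocity c t0) in d <> 0 ->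
  filterlim (fun s => circ S (g s) c) (at_right s0)
    (locally (circ S (g s0) c - d / Rabs d * PI)) /\
  filterlim (fun s => circ S (g s) c) (at_left s0)
    (locally (circ S (g s0) c + d / Rabs d * PI)).
Proof.
intros Hg Hc Ic Pc Sg Sc Hx far d Hd.
assert (Cg := smooth_continuous g s0 Hg).
assert (Ca : pcontinuous (pslope g s0) s0).
{ destruct (pslope_continuous_diag g s0 Hg) as (E1 & E2 & E3).
  split; [|split]; now apply (continuity_2d_section_r _ s0). }
assert (Ta := velocity_tangent S g s0 Hg Sg).
split.
- unfold d; rewrite <- pslope_diag.
  apply (circ_jump_right S g (pslope g s0)); trivial.
  + intros s; apply pslope_spec.
  + now rewrite pslope_diag.
  + now rewrite pslope_diag.
- (* This is the right limit for the reversed parametrization of [g]. *)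
  set (r := fun s => 2 * s0 - s).
  assert (R0 : r s0 = s0) by (unfold r; ring).
  assert (Cr : continuity_pt r s0).
  { apply derivable_continuous_pt; unfold r; auto_derive; trivial. }
  assert (Cp : forall h, pcontinuous h s0 -> pcontinuous (fun s => h (r s)) s0).
  { intros h (H1 & H2 & H3); split; [|split].
    - apply (continuity_pt_comp r (fun u => px (h u))); rewrite ?R0; trivial.
    - apply (continuity_pt_comp r (fun u => py (h u))); rewrite ?R0; trivial.
    - apply (continuity_pt_comp r (fun u => pz (h u))); rewrite ?R0; trivial. }
  assert (Ed : det3 (normal S (g (r s0))) (pscal (-1) (pslope g s0 (r s0))) (velocity c t0) = - d).
  { rewrite R0, pslope_diag; unfold d, det3; simpl; ring. }
  assert (J := circ_jump_right S (fun s => g (r s))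
    (fun s => pscal (-1) (pslope g s0 (r s))) c s0 t0).
  cbv beta in J; rewrite Ed, Rabs_Ropp, R0 in J.
  replace (circ S (g s0) c + d / Rabs d * PI)
    with (circ S (g s0) c - - d / Rabs d * PI) by (field; now apply Rabs_no_R0).
  assert (L : filterlim r (at_left s0) (at_right s0)).
  { intros P [e He]; exists e; intros s Bs Hs; apply He.
    - change (Rabs (s - s0) < e) in Bs; change (Rabs (r s - s0) < e).
      unfold r; rewrite <- Rabs_Ropp; now replace (- (2 * s0 - s - s0)) with (s - s0) by ring.
    - unfold r; lra. }
  apply (filterlim_ext (fun s => circ S (g (r (r s))) c)).
  { intros s; unfold r; do 2 f_equal; ring. }
  apply (filterlim_comp _ _ _ r (fun s => circ S (g (r s)) c) _ (at_right s0)); [exact L|].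
  apply J; trivial.
  + now apply Cp.
  + destruct (Cp _ Ca) as (H1 & H2 & H3).
    split; [|split]; apply (continuity_pt_mult (fun _ => -1)); trivial;
      now apply continuity_pt_const.
  + intros s; rewrite pslope_spec; unfold r, pscal; simpl; f_equal; ring.
  + rewrite pslope_diag; unfold dot in *; simpl in *; lra.
  + intros t Ht; apply (continuity_2d_comp (fun u v => kern S (g u) c v) (fun u v => r u) (fun u v => v)).
    * rewrite R0; now apply far.
    * apply (continuity_1d_2d_pt_comp r (fun u v => u)); [exact Cr|apply continuity_2d_pt_id1].
    * apply continuity_2d_pt_id2.
  + lra.
Qed.

(** * The Alexander numbering *)

Fixpoint fsum {n : nat} : (Fin.t n -> R) -> R :=
  match n with
  | O => fun _ => 0
  | S m => fun f => f Fin.F1 + fsum (fun i => f (Fin.FS i))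
  end.

Lemma fsum_ext n (f g : Fin.t n -> R) : (forall i, f i = g i) -> fsum f = fsum g.
Proof.
induction n as [|n IH]; intros H; simpl; [reflexivity|].
now rewrite H, (IH _ _ (fun i => H (Fin.FS i))).
Qed.

(** Serves the jump of the index, where the limit differs from the value in the summand of one
    component only. *)
Lemma fsum_add_at n (f : Fin.t n -> R) j x :
  fsum (fun i => f i + if Fin.eq_dec i j then x else 0) = fsum f + x.
Proof.
induction j as [n|n j IH]; cbn [fsum].
- rewrite (fsum_ext n _ (fun i => f (Fin.FS i))).
  + destruct Fin.eq_dec; [ring|easy].
  + intros i; destruct Fin.eq_dec; [easy|ring].
- rewrite (fsum_ext n _ (fun i => f (Fin.FS i) + if Fin.eq_dec i j then x else 0)).
  + rewrite (IH (fun i => f (Fin.FS i))); destruct Fin.eq_dec; [easy|ring].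
  + intros i; destruct (Fin.eq_dec i j) as [->|N]; destruct Fin.eq_dec as [E|N'];
      trivial; [easy|]; now apply Fin.FS_inj in E.
Qed.

Lemma fsum_filterlim {T : Type} (F : (T -> Prop) -> Prop) {FF : Filter F} n
    (f : T -> Fin.t n -> R) (l : Fin.t n -> R) :
  (forall i, filterlim (fun s => f s i) F (locally (l i))) ->
  filterlim (fun s => fsum (f s)) F (locally (fsum l)).
Proof.
induction n as [|n IH]; intros H; simpl.
- apply filterlim_const.
- apply (filterlim_comp_2 (G := locally (l Fin.F1))
    (H := locally (fsum (fun i => l (Fin.FS i))))
    (fun s => f s Fin.F1) (fun s => fsum (fun i => f s (Fin.FS i))) Rplus).
  + apply H.
  + apply (IH (fun s i => f s (Fin.FS i))); intros i; apply H.
  + apply (filterlim_plus (V := R_NormedModule)).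
Qed.

Lemma periodic_Z {T : Type} (f : R -> T) : (forall t, f (t + 1) = f t) ->
  forall k t, f (t + IZR k) = f t.
Proof.
intros H; apply (Z.bi_induction (fun k => forall t, f (t + IZR k) = f t)).
- now intros a b ->.
- intros t; now rewrite Rplus_0_r.
- intros k; split; intros K t.
  + now rewrite succ_IZR, <- Rplus_assoc, H.
  + rewrite <- (K t), succ_IZR, <- Rplus_assoc; symmetry; apply H.
Qed.

Lemma no_integer_between_0_1 k : ~ 0 < IZR k < 1.
Proof. intros [H K]; apply lt_IZR in H; apply lt_IZR in K; lia. Qed.

(** * The index of points of the diagram *)

Section Index.
Context (D : diagram).

Definition index (P : point) : R := fsum (fun k => circ (dsurf D) P (dcurve D k)).

Lemma same_param_sym n (p q : param n) : same_param p q -> same_param q p.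
Proof.
intros [E [k K]]; split; [easy|]; exists (- k)%Z; rewrite opp_IZR; lra.
Qed.

Lemma kern_continuous_regular i k s t :
  dcurve D k t <> dcurve D i s \/ same_param (i, s) (k, t) ->
  continuity_2d_pt (fun u v => kern (dsurf D) (dcurve D i u) (dcurve D k) v) s t.
Proof.
intros [N|[E [m Em]]]; simpl in *.
- apply kern_continuous_off; trivial; [apply dcurve_smooth|apply smooth_continuous, dcurve_smooth].
(* The two parameters differ by [m] periods; shifting the base parameter by [m] leads back to the
   diagonal. *)
- subst k s.
  apply continuity_2d_pt_ext with
    (fun u v => kern (dsurf D) (dcurve D i (u - IZR m)) (dcurve D i) v).
  { intros u v; rewrite <- (periodic_Z (dcurve D i) (dcurve_periodic D i) m (u - _)).
    do 2 f_equal; ring. }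
  apply (continuity_2d_comp (fun u v => kern (dsurf D) (dcurve D i u) (dcurve D i) v)
    (fun u v => u - IZR m) (fun u v => v)).
  + replace (t + IZR m - IZR m) with t by ring.
    apply kern_continuous_diag; [apply dcurve_smooth|apply dcurve_immersion].
  + apply continuity_2d_pt_minus; [apply continuity_2d_pt_id1|apply continuity_2d_pt_const].
  + apply continuity_2d_pt_id2.
Qed.

Lemma not_double_regular i k s t : ~ Defs.double D (i, s) ->
  dcurve D k t <> dcurve D i s \/ same_param (i, s) (k, t).
Proof.
intros N; destruct (classic (dcurve D k t = dcurve D i s)) as [E|E]; [right|now left].
apply NNPP; intros K; apply N; exists (k, t); split; [now symmetry|exact K].
Qed.

Lemma index_constant i a b : a <= b -> (forall r, a <= r <= b -> ~ Defs.double D (i, r)) ->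
  index (dcurve D i a) = index (dcurve D i b).
Proof.
intros [Hab|<-] Hd; [|reflexivity]; apply fsum_ext; intros k.
apply circ_constant; trivial; try apply dcurve_smooth; try apply dcurve_on.
- intros t; apply dcurve_immersion.
- intros t; apply dcurve_periodic.
- intros s t Hs; now apply kern_continuous_regular, not_double_regular, Hd.
- intros s t Hs; apply continuity_2d_swap, kern_continuous_regular.
  destruct (not_double_regular i k s t (Hd s Hs)); [left|right]; auto.
  now apply same_param_sym.
- intros s t Hs Ht; destruct (not_double_regular i k s (s + t) (Hd s Hs)) as [|[_ [m Hm]]];
    [assumption|simpl in Hm].
  destruct (no_integer_between_0_1 (- m)); rewrite opp_IZR; lra.
Qed.

Lemma index_joined p q : joined D p q ->
  index (curve_at (dcurve D) p) = index (curve_at (dcurve D) q).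
Proof.
destruct p as [i s], q as [j t]; intros [E [k H]]; simpl in *; subst j; unfold curve_at; simpl.
rewrite <- (periodic_Z (dcurve D i) (dcurve_periodic D i) k t).
destruct (Rle_dec s (t + IZR k)) as [L|L].
- rewrite Rmin_left, Rmax_right in H by lra; now apply index_constant.
- rewrite Rmin_right, Rmax_left in H by lra; symmetry; apply index_constant; [lra|exact H].
Qed.

(** Absence of triple points makes [(j, t)] the only parameter, up to periods, at which the kernel
    may fail to be jointly continuous. So only the summand of the component [j] jumps, including
    when [i = j] and that component is also the one carrying the moving point. *)
Lemma index_jump i s j t : double_pair (dcurve D) (i, s) (j, t) ->
  let P := dcurve D i s in
  let d := det3 (velocity (dcurve D i) s) (velocity (dcurve D j) t) (normal (dsurf D) P) in
  filterlim (fun u => index (dcurve D i u)) (at_right s) (locally (index P - d / Rabs d * PI)) /\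
  filterlim (fun u => index (dcurve D i u)) (at_left s) (locally (index P + d / Rabs d * PI)).
Proof.
intros H P d.
assert (Hd : d <> 0) by exact (dcurve_transverse D _ _ H).
assert (Reg : forall k u, ~ same_param (j, t) (k, u) ->
  continuity_2d_pt (fun x v => kern (dsurf D) (dcurve D i x) (dcurve D k) v) s u).
{ intros k u N; apply kern_continuous_regular.
  destruct (classic (dcurve D k u = dcurve D i s)) as [E|E]; [right|now left].
  apply NNPP; intros K; apply N, (dcurve_no_triple D _ _ _ H); split; [now symmetry|exact K]. }
assert (Oth : forall k, k <> j -> filterlim (fun u => circ (dsurf D) (dcurve D i u) (dcurve D k))
  (locally s) (locally (circ (dsurf D) P (dcurve D k)))).
{ intros k Nk; apply (RInt_param_continuous (fun u => kern (dsurf D) (dcurve D i u) (dcurve D k)));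
    [lra| |].
  - intros u _; apply Reg; intros [E _]; now apply Nk.
  - intros u; apply continuous_ex_RInt; intros v; apply kern_continuous;
      [apply dcurve_smooth|exact (dcurve_immersion D k)]. }
destruct (circ_jump (dsurf D) (dcurve D i) (dcurve D j) s t) as [JR JL];
  try apply dcurve_smooth; try apply dcurve_on.
- exact (dcurve_immersion D j).
- exact (dcurve_periodic D j).
- exact (proj1 H).
- intros u Hu; apply Reg; intros [_ [m Hm]]; simpl in Hm.
  destruct (no_integer_between_0_1 (- m)); rewrite opp_IZR; lra.
- intros E; apply Hd; rewrite <- E; unfold d, P, det3; ring.
- replace (det3 (normal (dsurf D) (dcurve D i s)) (velocity (dcurve D i) s) (velocity (dcurve D j) t))
    with d in JR, JL by (unfold d, P, det3; ring).
  split.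
  + replace (index P - d / Rabs d * PI) with (index P + - (d / Rabs d * PI)) by ring.
    unfold index at 2; rewrite <- (fsum_add_at _ _ j).
    apply (fsum_filterlim (at_right s)); intros k; destruct (Fin.eq_dec k j) as [->|Nk];
      [exact JR|].
    rewrite Rplus_0_r; eapply filterlim_filter_le_1; [|apply Oth, Nk]; apply filter_le_within.
  + unfold index at 2; rewrite <- (fsum_add_at _ _ j).
    apply (fsum_filterlim (at_left s)); intros k; destruct (Fin.eq_dec k j) as [->|Nk];
      [exact JL|].
    rewrite Rplus_0_r; eapply filterlim_filter_le_1; [|apply Oth, Nk]; apply filter_le_within.
Qed.

Definition semiarc_index (a : semiarc D) : R :=
  index (curve_at (dcurve D) (proj1_sig (constructive_indefinite_description _ (proj2_sig a)))).

Lemma semiarc_index_on a p : on_semiarc D a p -> index (curve_at (dcurve D) p) = semiarc_index a.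
Proof.
unfold semiarc_index; destruct constructive_indefinite_description as [r [Hr E]]; simpl.
intros H; symmetry; now apply index_joined, E.
Qed.

(** The index is constant on the semiarc, so its limit at the end point is that constant. A limit is
    taken because at a double point the index has the intermediate value. *)
Lemma semiarc_index_start a i s l : starts_at D a (i, s) ->
  filterlim (fun u => index (dcurve D i u)) (at_right s) (locally l) -> semiarc_index a = l.
Proof.
intros [e [He H]] L.
apply (filterlim_locally_unique (V := R_NormedModule) (F := at_right s)
  (fun u => index (dcurve D i u))); [|exact L].
apply (filterlim_ext_loc (fun _ => semiarc_index a)); [|apply filterlim_const].
exists (mkposreal _ He); simpl; intros u Bu Hu; change (Rabs (u - s) < e) in Bu.
apply Rabs_def2 in Bu; symmetry; apply (semiarc_index_on a (i, u)).
replace u with (s + (u - s)) by ring; apply H; lra.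
Qed.

Lemma semiarc_index_end a i s l : ends_at D a (i, s) ->
  filterlim (fun u => index (dcurve D i u)) (at_left s) (locally l) -> semiarc_index a = l.
Proof.
intros [e [He H]] L.
apply (filterlim_locally_unique (V := R_NormedModule) (F := at_left s)
  (fun u => index (dcurve D i u))); [|exact L].
apply (filterlim_ext_loc (fun _ => semiarc_index a)); [|apply filterlim_const].
exists (mkposreal _ He); simpl; intros u Bu Hu; change (Rabs (u - s) < e) in Bu.
apply Rabs_def2 in Bu; symmetry; apply (semiarc_index_on a (i, u)).
replace u with (s - (s - u)) by ring; apply H; lra.
Qed.

Lemma up_plus_1 x : up (x + 1) = (up x + 1)%Z.
Proof. symmetry; destruct (archimed x); apply tech_up; rewrite plus_IZR; lra. Qed.

Lemma alexander_numbering_exists : exists n, alexander_numbering D n.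
Proof.
(* [up] is the integer part plus one; the shift is harmless, since only differences enter a
   numbering and [up] commutes with adding 1. *)
exists (fun a => up (- semiarc_index a / (2 * PI))).
intros [i s] [j t] x y z w (H & Hd & Ex & Sw & Ey & Sz).
assert (H' : double_pair (dcurve D) (j, t) (i, s)).
{ destruct H as [E N]; split; [now symmetry|]; intros K; now apply N, same_param_sym. }
destruct (index_jump _ _ _ _ H) as [R1 L1], (index_jump _ _ _ _ H') as [R2 L2].
unfold curve_at, velocity_at in Hd; simpl in Hd.
assert (E := proj1 H); unfold curve_at in E; simpl in E; rewrite <- E in R2, L2.
set (d := det3 (velocity (dcurve D i) s) (velocity (dcurve D j) t) _) in *.
replace (det3 (velocity (dcurve D j) t) (velocity (dcurve D i) s)
  (normal (dsurf D) (dcurve D i s))) with (- d) in R2, L2 by (unfold d, det3; ring).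
(* Exchanging the strands changes the sign of [d]. With [I] the index at the double point, [x] and
   [z] get [I - PI] while [y] and [w] get [I + PI]; division by [- 2 * PI] puts [x] exactly one
   above [y]. *)
assert (Q1 : d / Rabs d = -1) by (rewrite Rabs_left by exact Hd; field; lra).
assert (Q2 : - d / Rabs (- d) = 1) by (rewrite Rabs_right by lra; field; lra).
rewrite Q1 in R1, L1; rewrite Q2 in R2, L2.
rewrite (semiarc_index_end _ _ _ _ Ex L1), (semiarc_index_start _ _ _ _ Sw R1).
rewrite (semiarc_index_end _ _ _ _ Ey L2), (semiarc_index_start _ _ _ _ Sz R2).
assert (PP := PI_RGT_0); rewrite <- up_plus_1.
split; [|split]; f_equal; field; lra.
Qed.

End Index.

Theorem theorem4p3 (D : diagram) : vb_isomorphic (newVBQ D) (VBQ D).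
Proof.
destruct (alexander_numbering_exists D) as [n Hn]; exact (isomorphic_of_numbering D n Hn).
Qed.
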